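(* Let $S$ be a bounded self-adjoint operator in a Krein space $(\mathcal H,[\cdot,\cdot])$. Then $S$ is a $J$-frame operator if and only if there exists a fundamental decomposition $\mathcal H=\mathcal H_+\,[\dotplus]\,\mathcal H_-$ such that $S$ admits, with respect to this decomposition, a representation of the form $$S=\begin{bmatrix} A & -AK\\ K^*A & D\end{bmatrix},$$ where $A$ is a uniformly positive operator in the Hilbert space $(\mathcal H_+,[\cdot,\cdot])$, $K:\mathcal H_-\to\mathcal H_+$ is a uniform contraction (i.e. $\|K\|<1$), and $D$ is a self-adjoint operator such that $D+K^*AK$ is uniformly positive in the Hilbert space $(\mathcal H_-,-[\cdot,\cdot])$.
   Context: Krein spaces (over $\mathbb C$). A Krein space $(\mathcal H,[\cdot,\cdot])$ is a vector space with a Hermitian sesquilinear form admitting a fundamental decomposition $\mathcal H=\mathcal H_+\,[\dotplus]\,\mathcal H_-$, i.e. a direct, $[\cdot,\cdot]$-orthogonal sum such that $(\mathcal H_+,[\cdot,\cdot])$ and $(\mathcal H_-,-[\cdot,\cdot])$ are Hilbert spaces. The associated Hilbert inner product is $\langle x_++x_-,y_++y_-\rangle=[x_+,y_+]-[x_-,y_-]$; the norms coming from different fundamental decompositions are equivalent, so the topology of $\mathcal H$ is independent of the choice. For Krein spaces $\mathcal H,\mathcal K$ and bounded $T:\mathcal H\to\mathcal K$, $T^+:\mathcal K\to\mathcal H$ is the operator with $[Tx,y]=[x,T^+y]$; $T:\mathcal H\to\mathcal H$ is self-adjoint in the Krein space if $T=T^+$. A subspace $\mathcal L$ is uniformly positive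 (negative) if there is $\alpha>0$ with $[x,x]\ge\alpha\|x\|^2$ (resp. $-[x,x]\ge\alpha\|x\|^2$) for all $x\in\mathcal L$; maximal means maximal with respect to inclusion among such subspaces. $J$-frames. A family $\mathcal F=\{f_i\}_{i\in I}$ in $\mathcal H$ is a Bessel family if $\sum_{i\in I}|\langle f,f_i\rangle|^2\le\beta\|f\|^2$ for all $f$, for some $\beta<\infty$. Its synthesis operator is the bounded operator $T:\ell_2(I)\to\mathcal H$, $Tx=\sum_{i\in I}x_if_i$. Put $I_+=\{i:[f_i,f_i]\ge0\}$, $I_-=\{i:[f_i,f_i]<0\}$, and $T_\pm x=\sum_{i\in I_\pm}x_if_i$. $\mathcal F$ is a $J$-frame for $\mathcal H$ if the range $R(T_+)$ is a maximal uniformly positive subspace and $R(T_-)$ is a maximal uniformly negative subspace of $\mathcal H$. The $J$-frame operator of $\mathcal F$ is $Sf=\sum_{i\in I_+}[f,f_i]f_i-\sum_{i\in I_-}[f,f_i]f_i$, $f\in\mathcal H$. An operator $S$ is called a $J$-frame operator if it is the $J$-frame operator of some $J$-frame for $\mathcal H$. Operators. Block operator matrices act on $x_++x_-$ as column vectors and have bounded entries. $K^*:\mathcal H_+\to\mathcal H_-$ is the Hilbert space adjoint of $K$ with respect to the Hilbert spaces $(\mathcal H_-,-[\cdot,\cdot])$ and $(\mathcal H_+,[\cdot,\cdot])$, and $\|K\|$ is the norm with respect to these. Self-adjointness of $A$ and $D$ is meant in these Hilbert spaces. A bounded self-adjoint operator in a Hilbert space is uniformly positive if it is positive-definite and boundedly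 invertible. *)

(* Defs.v *)
From HB Require Import structures.
From mathcomp Require Import all_boot all_order all_algebra.
From mathcomp Require Import finmap sesquilinear complex.
From mathcomp Require Import boolp classical_sets reals ereal topology normedtype.
From mathcomp Require Import esum.
From mathcomp.analysis.showcase Require Import summability.

Set Implicit Arguments.
Unset Strict Implicit.
Unset Printing Implicit Defensive.

Import Order.TTheory GRing.Theory Num.Theory.
Import numFieldNormedType.Exports.
Import ComplexField.Normc.

Local Open Scope classical_set_scope.
Local Open Scope ring_scope.

(* Sesquilinear forms with [form y x] the conjugate of [form x y]; they are
   linear in the first argument. *)
Notation hermitian_form V := {hermitian V for false & @conjc _}.

Section Subspace.
Context {R : realType} {H : lmodType R[i]}.
Variable L : submodClosed H.

Definition subspace : Type := {x : H | x \in L}.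

HB.instance Definition _ := SubChoice.copy subspace {x : H | x \in L}.
HB.instance Definition _ := [SubChoice_isSubLmodule of subspace by <:].

End Subspace.

Section DerivedForms.
Context {R : realType} {V : lmodType R[i]}.
Variables (form : hermitian_form V) (L : submodClosed V).

Definition opp_form (x y : V) : R[i] := - form x y.

Lemma opp_form_bilinear :
  bilinear_for ( *%R : R[i] -> R[i] -> R[i]) (@conjc R \; *%R) opp_form.
Proof.
split=> u a x y; rewrite /opp_form.
  by rewrite linearPl /= opprD mulrN.
by rewrite linearPr /= opprD mulrN.
Qed.

Lemma opp_form_hermitian x y :
  opp_form x y = (-1) ^+ false * conjc (opp_form y x).
Proof. by rewrite /opp_form hermitian_subproof !expr0 !mul1r rmorphN. Qed.

HB.instance Definition _ :=
  bilinear_isBilinear.Build _ _ _ _ _ _ opp_form opp_form_bilinear.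
HB.instance Definition _ :=
  isHermitianSesquilinear.Build _ _ _ _ opp_form opp_form_hermitian.

Definition sub_form (x y : subspace L) : R[i] := form (\val x) (\val y).

Lemma sub_form_bilinear :
  bilinear_for ( *%R : R[i] -> R[i] -> R[i]) (@conjc R \; *%R) sub_form.
Proof.
have valPL a (x y : subspace L) : \val (a *: x + y) = a *: \val x + \val y :> V.
  by rewrite linearP.
split=> u a x y; rewrite /sub_form valPL /=.
  by rewrite linearPl.
by rewrite linearPr.
Qed.

Lemma sub_form_hermitian x y :
  sub_form x y = (-1) ^+ false * conjc (sub_form y x).
Proof. exact: hermitian_subproof. Qed.

HB.instance Definition _ :=
  bilinear_isBilinear.Build _ _ _ _ _ _ sub_form sub_form_bilinear.
HB.instance Definition _ :=
  isHermitianSesquilinear.Build _ _ _ _ sub_form sub_form_hermitian.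

End DerivedForms.

Arguments sub_form {R V} form L x y.

Section HilbertSpaces.
Context {R : realType}.
Implicit Types V W : lmodType R[i].

Definition ip_norm V (ip : V -> V -> R[i]) (x : V) : R :=
  Num.sqrt (complex.Re (ip x x)).

Definition ip_cauchy V (ip : V -> V -> R[i]) (u : nat -> V) : Prop :=
  forall e : R, 0 < e ->
    exists N, forall m n, (N <= m)%N -> (N <= n)%N -> ip_norm ip (u m - u n) < e.

Definition is_hilbert V (ip : hermitian_form V) : Prop :=
  (forall x, x != 0 -> 0 < ip x x) /\
  (forall u, ip_cauchy ip u ->
     exists l, ip_norm ip (u n - l) @[n --> \oo] --> (0 : R)).

Definition bounded_op V W (ipV : V -> V -> R[i]) (ipW : W -> W -> R[i])
    (T : V -> W) : Prop :=
  exists M : R, forall x, ip_norm ipW (T x) <= M * ip_norm ipV x.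

(* Meaningful only if [bounded_op ipV ipW T] holds. *)
Definition op_norm V W (ipV : V -> V -> R[i]) (ipW : W -> W -> R[i])
    (T : V -> W) : R :=
  sup [set ip_norm ipW (T x) | x in [set x | ip_norm ipV x <= 1]].

Definition uniform_contraction V W (ipV : V -> V -> R[i])
    (ipW : W -> W -> R[i]) (T : V -> W) : Prop :=
  bounded_op ipV ipW T /\ op_norm ipV ipW T < 1.

Definition is_adjoint V W (ipV : V -> V -> R[i]) (ipW : W -> W -> R[i])
    (T : V -> W) (T' : W -> V) : Prop :=
  forall x y, ipW (T x) y = ipV x (T' y).

Definition bounded_selfadjoint V (ip : V -> V -> R[i]) (T : V -> V) : Prop :=
  bounded_op ip ip T /\ is_adjoint ip ip T T.

Definition boundedly_invertible V (ip : V -> V -> R[i]) (T : V -> V) : Prop :=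
  exists T' : {linear V -> V},
    [/\ bounded_op ip ip T', cancel T T' & cancel T' T].

Definition uniformly_positive_op V (ip : V -> V -> R[i]) (T : V -> V) : Prop :=
  [/\ bounded_selfadjoint ip T, forall x, x != 0 -> 0 < ip (T x) x
    & boundedly_invertible ip T].

End HilbertSpaces.

Section KreinSpaces.
Context {R : realType} {H : lmodType R[i]}.
Variable form : hermitian_form H.

Definition pos_form (Hp : submodClosed H) : hermitian_form (subspace Hp) :=
  sub_form form Hp.

Definition neg_form (Hm : submodClosed H) : hermitian_form (subspace Hm) :=
  opp_form (sub_form form Hm).

Definition fundamental_decomposition (Hp Hm : submodClosed H) : Prop :=
  [/\ forall x, exists (y : subspace Hp) (z : subspace Hm), x = \val y + \val z,
      forall x, x \in Hp -> x \in Hm -> x = 0,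
      forall x y, x \in Hp -> y \in Hm -> form x y = 0,
      is_hilbert (pos_form Hp)
    & is_hilbert (neg_form Hm)].

(* The component of x in L along M, for H the direct sum of L and M. *)
Definition component (L M : submodClosed H) (x : H) : H :=
  xget 0 [set y | y \in L /\ x - y \in M].

Definition fund_ip (Hp Hm : submodClosed H) (x y : H) : R[i] :=
  form (component Hp Hm x) (component Hp Hm y)
  - form (component Hm Hp x) (component Hm Hp y).

Definition block_operator (Hp Hm : submodClosed H) (S : H -> H)
    (Spp : subspace Hp -> subspace Hp) (Spm : subspace Hm -> subspace Hp)
    (Smp : subspace Hp -> subspace Hm) (Smm : subspace Hm -> subspace Hm) : Prop :=
  forall (x : subspace Hp) (y : subspace Hm),
    S (\val x + \val y) = \val (Spp x + Spm y) + \val (Smp x + Smm y).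

End KreinSpaces.

(* [ip] is the Hilbert inner product of some fundamental decomposition; it
   provides the norm. *)
Section JFrames.
Context {R : realType} {H : lmodType R[i]}.
Variables (form : hermitian_form H) (ip : H -> H -> R[i]).
Local Notation norm := (ip_norm ip).

Definition uniformly_positive (g : H -> H -> R[i]) (L : set H) : Prop :=
  exists2 alpha : R, 0 < alpha &
    forall x, L x -> alpha * norm x ^+ 2 <= complex.Re (g x x).

Definition maximal_uniformly_positive (g : H -> H -> R[i]) (L : set H) : Prop :=
  [/\ submod_closed (mem L), uniformly_positive g L &
      forall L' : set H, submod_closed (mem L') -> uniformly_positive g L' ->
        L `<=` L' -> L' = L].

Section Families.
Variable I : choiceType.
Implicit Types (u f : I -> H) (P : pred I).

Definition has_sum P u (v : H) : Prop :=
  norm (\sum_(i <- enum_fset A | P i) u i - v) @[A --> totally] --> (0 : R).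

(* The unconditional sum of the u i with P i; it is 0 if there is none. *)
Definition usum P u : H := xget 0 [set v | has_sum P u v].

Definition ell2 : set (I -> R[i]) :=
  [set x | (\esum_(i in [set: I]) (normc (x i) ^+ 2)%:E < +oo)%E].

Definition bessel f : Prop :=
  exists beta : R, forall x,
    (\esum_(i in [set: I]) (normc (ip x (f i)) ^+ 2)%:E
       <= (beta * norm x ^+ 2)%:E)%E.

Definition synthesis P f (x : I -> R[i]) : H := usum P (fun i => x i *: f i).

Definition pos_idx f : pred I := [pred i | 0 <= form (f i) (f i)].
Definition neg_idx f : pred I := [pred i | form (f i) (f i) < 0].

Definition J_frame f : Prop :=
  [/\ bessel f,
      maximal_uniformly_positive form (synthesis (pos_idx f) f @` ell2)
    & maximal_uniformly_positive (opp_form form)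
        (synthesis (neg_idx f) f @` ell2)].

Definition J_frame_op f (x : H) : H :=
  usum (pos_idx f) (fun i => form x (f i) *: f i)
  - usum (neg_idx f) (fun i => form x (f i) *: f i).

End Families.

Definition is_J_frame_operator (S : H -> H) : Prop :=
  exists (I : choiceType) (f : I -> H), J_frame f /\ S =1 J_frame_op f.

End JFrames.

(* Main.v *)
Require Import Defs.
From HB Require Import structures.
From mathcomp Require Import all_boot all_order all_algebra.
From mathcomp Require Import finmap sesquilinear complex.
From mathcomp Require Import boolp classical_sets reals ereal topology normedtype sequences.
From mathcomp Require Import cardinality fsbigop esum.
From mathcomp.analysis.showcase Require Import summability.
From mathcomp Require Import ring lra.
Import Defs.

Set Implicit Arguments.
Unset Strict Implicit.
Unset Printing Implicit Defensive.

Import Order.TTheory GRing.Theory Num.Theory.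
Import numFieldNormedType.Exports.
Import ComplexField.Normc.

Local Open Scope classical_set_scope.
Local Open Scope ring_scope.

(** From a J-frame to the block form.  The range [L-] of the negative synthesis
    operator is maximal uniformly negative, so it and its orthogonal complement
    form a fundamental decomposition [H = Hp + Hm] with [Hm = L-]
    ([max_unif_pos_decomposition], used for the form with the opposite sign).
    Write [S = Sp - Sm], where [Sp] and [Sm] are the sums over the indices of
    positive and negative type, and let [P] and [Q] be the projections onto [Hp]
    and [Hm].  Then [Sm] has range in [Hm] and vanishes on
    [Hp], and [Sp] has range in [L+], which is uniformly positive.  With
    [A = P S] on [Hp], the vector [S (A^-1 x)] lies in [L+] and has positive part
    [x], so [L+] is the graph of [K' = Q S A^-1], and uniform positivity of [L+]
    says exactly that [K'] is a uniform contraction.  Symmetry of [S] makes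
    [K = - A^-1 P S] on [Hm] the adjoint of [K'], and for [y] in [Hm] the vector
    [Sp y] lies on the graph, whence [D + K' A K = - Sm] on [Hm]
    ([block_representation_of_splitting]).  It remains to see that [A] and [- Sm]
    are bounded below.  This is the lower frame bound ([lower_frame_bound]),
    directly for [- Sm]; for [A] it bounds the component of [x] in [L+], which
    suffices because the complement of [L+] is negative.

    From the block form to a J-frame.  Put [C = D + K' A K].  The block form says
    that [S z = T (A w) + C y], where [x] and [y] are the components of [z],
    [w = x - K y] and [T x = x + K' x].  An orthonormal basis [e] for the
    inner product [<A^-1 x, y>] satisfies [A x = \sum_i <x, e i> e i], and
    likewise for [C] ([inverse_inner_product]); so the vectors [T (e i)],
    together with a basis of the same kind for [C], have [S] as J-frame
    operator.  Their synthesis operators have range the graph of [K'] and [Hm],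
    which are maximal ([contraction_graph_maximal]).

    All the quantitative facts come from the uniform boundedness principle in a
    Hilbert space ([uniform_boundedness]): a symmetric operator is bounded, two
    fundamental decompositions have equivalent norms, and a Bessel family with
    surjective synthesis operator has a lower frame bound. *)

Local Notation Re := complex.Re.
Local Notation Im := complex.Im.

(** * Hermitian functions and semi-inner products *)

Section ComplexNumbers.
Context {R : realType}.
Implicit Types z w : R[i].

Lemma sqr_normc z : normc z ^+ 2 = Re z ^+ 2 + Im z ^+ 2.
Proof. by case: z => a b /=; rewrite sqr_sqrtr // addr_ge0 // sqr_ge0. Qed.

Lemma normc_ge0 z : 0 <= normc z.
Proof. by case: z => a b; exact: sqrtr_ge0. Qed.

Lemma normc_conj z : normc (conjc z) = normc z.
Proof. by case: z => a b /=; rewrite sqrrN. Qed.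

Lemma mulc_conj z : z * conjc z = (normc z ^+ 2)%:C%C.
Proof.
rewrite sqr_normc; case: z => a b; apply/eqP; rewrite eq_complex /=.
by apply/andP; split; apply/eqP; ring.
Qed.

Lemma conjcM z w : conjc (z * w) = conjc z * conjc w.
Proof. exact: rmorphM. Qed.

Lemma conjcD z w : conjc (z + w) = conjc z + conjc w.
Proof. exact: rmorphD. Qed.

Lemma conjcN z : conjc (- z) = - conjc z.
Proof. exact: rmorphN. Qed.

Lemma normc_real (t : R) : normc (t%:C)%C = `|t|.
Proof. by rewrite /normc /= expr0n /= addr0 sqrtr_sqr. Qed.

Lemma Re_le_normc z : Re z <= normc z.
Proof.
apply: le_trans (ler_norm _) _; rewrite -sqrtr_sqr -[leRHS]ger0_norm ?normc_ge0 //.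
by rewrite -[leRHS]sqrtr_sqr ler_wsqrtr // sqr_normc lerDl sqr_ge0.
Qed.

Lemma ReM_real (t : R) z : Re (t%:C%C * z) = t * Re z.
Proof. by case: z => a b /=; rewrite mul0r subr0. Qed.

Lemma ReD z w : Re (z + w) = Re z + Re w.
Proof. by case: z; case: w. Qed.

Lemma ReN z : Re (- z) = - Re z.
Proof. by case: z. Qed.

Lemma ReB z w : Re (z - w) = Re z - Re w.
Proof. by rewrite ReD ReN. Qed.

Lemma ler_distc z w : normc z - normc w <= normc (z + w).
Proof.
rewrite lerBlDr -[X in normc X <= _](addrK w) -(normcN w).
exact: le_normcD.
Qed.

End ComplexNumbers.

Section HermitianFunctions.
Context {R : realType} {V : lmodType R[i]}.
Implicit Types (g : V -> V -> R[i]) (x y z : V).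

(** Most forms below are not canonical Hermitian structures (a Hilbert inner
    product depends on proofs about the decomposition), so the algebraic
    properties are carried by predicates on bare functions. *)
Definition hermitian_fun g : Prop :=
  (forall a x y z, g (a *: x + y) z = a * g x z + g y z) /\
  (forall x y, g y x = conjc (g x y)).

Definition semi_inner_product g : Prop :=
  hermitian_fun g /\ forall x, 0 <= Re (g x x).

Definition inner_product g : Prop :=
  semi_inner_product g /\ forall x, Re (g x x) = 0 -> x = 0.

Definition complete_ip g : Prop := forall u, ip_cauchy g u ->
  exists l, forall e : R, 0 < e ->
    exists N, forall n, (N <= n)%N -> ip_norm g (u n - l) < e.

Lemma hermitian_form_fun (form : hermitian_form V) : hermitian_fun form.
Proof.
split=> [a x y z|x y]; first exact: linearPl.
by rewrite [LHS]hermitian_subproof expr0 mul1r.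
Qed.

Section Algebra.
Context (g : V -> V -> R[i]) (hg : hermitian_fun g).

Lemma herm_conj x y : g y x = conjc (g x y). Proof. exact: hg.2. Qed.

Lemma hermDl x y z : g (x + y) z = g x z + g y z.
Proof. by have := hg.1 1 x y z; rewrite scale1r mul1r. Qed.

Lemma herm0l z : g 0 z = 0.
Proof. by apply: (@addrI _ (g 0 z)); rewrite -hermDl !addr0. Qed.

Lemma hermZl a x z : g (a *: x) z = a * g x z.
Proof. by have := hg.1 a x 0 z; rewrite addr0 herm0l addr0. Qed.

Lemma hermNl x z : g (- x) z = - g x z.
Proof. by rewrite -scaleN1r hermZl mulN1r. Qed.

Lemma hermBl x y z : g (x - y) z = g x z - g y z.
Proof. by rewrite hermDl hermNl. Qed.

Lemma hermDr x y z : g z (x + y) = g z x + g z y.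
Proof. by rewrite !(herm_conj _ z) hermDl conjcD. Qed.

Lemma herm0r z : g z 0 = 0.
Proof. by rewrite herm_conj herm0l conjc0. Qed.

Lemma hermZr a x z : g z (a *: x) = conjc a * g z x.
Proof. by rewrite !(herm_conj _ z) hermZl conjcM. Qed.

Lemma hermNr x z : g z (- x) = - g z x.
Proof. by rewrite !(herm_conj _ z) hermNl conjcN. Qed.

Lemma hermBr x y z : g z (x - y) = g z x - g z y.
Proof. by rewrite hermDr hermNr. Qed.

Lemma herm_suml (J : Type) (r : seq J) P (F : J -> V) z :
  g (\sum_(i <- r | P i) F i) z = \sum_(i <- r | P i) g (F i) z.
Proof.
by apply: (big_morph (g^~ z)); [move=> x y; exact: hermDl|exact: herm0l].
Qed.

Lemma herm_sumr (J : Type) (r : seq J) P (F : J -> V) z :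
  g z (\sum_(i <- r | P i) F i) = \sum_(i <- r | P i) g z (F i).
Proof.
by apply: (big_morph (g z)); [move=> x y; exact: hermDr|exact: herm0r].
Qed.

Lemma Im_herm x : Im (g x x) = 0.
Proof.
have := congr1 (fun c : R[i] => Im c) (herm_conj x x).
by case: (g x x) => a b /= h; lra.
Qed.

Lemma herm_real x : g x x = (Re (g x x))%:C%C.
Proof. by apply/eqP; rewrite eq_complex /= Im_herm !eqxx. Qed.

Lemma Re_hermC x y : Re (g y x) = Re (g x y).
Proof. by rewrite herm_conj; case: (g x y). Qed.

Lemma normc_hermC x y : normc (g y x) = normc (g x y).
Proof. by rewrite herm_conj normc_conj. Qed.

Lemma Re_hermZ a x : Re (g (a *: x) (a *: x)) = normc a ^+ 2 * Re (g x x).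
Proof. by rewrite hermZl hermZr mulrA mulc_conj ReM_real. Qed.

Lemma Re_hermD x y :
  Re (g (x + y) (x + y)) = Re (g x x) + 2 * Re (g x y) + Re (g y y).
Proof. by rewrite hermDl !hermDr !ReD (Re_hermC x y); ring. Qed.

Lemma Re_hermN x : Re (g (- x) (- x)) = Re (g x x).
Proof. by rewrite hermNl hermNr opprK. Qed.

End Algebra.

(** The quadratic is [|x - t * c *: y|^2] for [c = g x y] and [b = |c|^2]; its
    discriminant is nonpositive. *)
Lemma discriminant_le (a b d : R) : 0 <= b -> 0 <= d ->
  (forall t, 0 <= a - 2 * t * b + t ^+ 2 * b * d) -> b <= a * d.
Proof.
move=> b0 d0 h; have [d_eq0|d_neq0] := eqVneq d 0.
  rewrite d_eq0 mulr0; apply: contrapT => /negP; rewrite -ltNge => bpos.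
  have := h ((a + 1) / (2 * b)); rewrite d_eq0 mulr0 addr0.
  have -> : 2 * ((a + 1) / (2 * b)) * b = a + 1 by field; rewrite gt_eqF.
  lra.
have dpos : 0 < d by rewrite lt_def d_neq0.
have := h d^-1.
have -> : a - 2 * d^-1 * b + d^-1 ^+ 2 * b * d = (a * d - b) / d by field.
by rewrite pmulr_lge0 ?invr_gt0 // subr_ge0.
Qed.

Section SemiInnerProduct.
Context (g : V -> V -> R[i]) (sg : semi_inner_product g).
Let hg : hermitian_fun g := sg.1.
Local Notation nrm := (ip_norm g).

Lemma sqr_ip_norm x : nrm x ^+ 2 = Re (g x x).
Proof. by rewrite sqr_sqrtr // sg.2. Qed.

Lemma ip_norm_ge0 x : 0 <= nrm x.
Proof. exact: sqrtr_ge0. Qed.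

Lemma cauchy_schwarz x y : normc (g x y) <= nrm x * nrm y.
Proof.
rewrite -(@ler_pXn2r _ 2) // ?nnegrE ?mulr_ge0 ?normc_ge0 ?ip_norm_ge0 //.
rewrite exprMn !sqr_ip_norm; apply: discriminant_le; rewrite ?sqr_ge0 ?sg.2 //.
move=> t; have := sg.2 (x + ((- t)%:C%C * g x y) *: y).
rewrite Re_hermD // Re_hermZ // hermZr //. rewrite conjcM conjc_real -mulrA.
rewrite ReM_real [conjc _ * _]mulrC mulc_conj normcM normc_real normrN /=.
rewrite exprMn real_normK ?num_real //.
congr (0 <= _); ring.
Qed.

Lemma ip_normZ a x : nrm (a *: x) = normc a * nrm x.
Proof.
by rewrite /ip_norm Re_hermZ // sqrtrM ?sqr_ge0 // sqrtr_sqr ger0_norm // normc_ge0.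
Qed.

Lemma ip_norm0 : nrm 0 = 0.
Proof. by rewrite /ip_norm herm0l // sqrtr0. Qed.

Lemma ip_normN x : nrm (- x) = nrm x.
Proof. by rewrite /ip_norm Re_hermN. Qed.

Lemma ip_normD x y : nrm (x + y) <= nrm x + nrm y.
Proof.
rewrite -(@ler_pXn2r _ 2) // ?nnegrE ?addr_ge0 ?ip_norm_ge0 //.
rewrite sqrrD !sqr_ip_norm Re_hermD // lerD2r lerD2l -[leRHS]mulr_natl ler_pM2l //.
exact: le_trans (Re_le_normc _) (cauchy_schwarz _ _).
Qed.

Lemma ip_norm_subC x y : nrm (x - y) = nrm (y - x).
Proof. by rewrite -ip_normN opprB. Qed.

Lemma ip_norm_trans y x z : nrm (x - z) <= nrm (x - y) + nrm (y - z).
Proof. by have -> : x - z = (x - y) + (y - z); [rewrite addrA subrK|exact: ip_normD]. Qed.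

Lemma ip_norm_le x (M : R) : 0 <= M -> Re (g x x) <= M ^+ 2 -> nrm x <= M.
Proof.
move=> M0 h; rewrite -(@ler_pXn2r _ 2) ?nnegrE ?ip_norm_ge0 //.
by rewrite sqr_ip_norm.
Qed.

End SemiInnerProduct.

Lemma ip_norm_eq0 g x : inner_product g -> ip_norm g x = 0 -> x = 0.
Proof. by move=> ig h; apply: ig.2; rewrite -(sqr_ip_norm ig.1) h expr0n. Qed.

End HermitianFunctions.
#[global] Hint Resolve normc_ge0 ip_norm_ge0 : core.

(** * The uniform boundedness principle *)

Section UniformBoundedness.
Context {R : realType} {V : lmodType R[i]}.
Context (g : V -> V -> R[i]) (ig : inner_product g) (cg : complete_ip g).
Let sg : semi_inner_product g := ig.1.
Let hg : hermitian_fun g := sg.1.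
Local Notation nrm := (ip_norm g).
Local Notation q n := ((4^-1 : R) ^+ n).

Lemma q_gt0 n : 0 < q n.
Proof. by rewrite exprn_gt0 // invr_gt0. Qed.

Lemma q_small (e : R) : 0 < e -> exists N, forall n, (N <= n)%N -> q n < e.
Proof.
move=> e0; have := @cvg_expr R 4^-1; rewrite ger0_norm; last by lra.
move=> /(_ _)/cvgrPdist_lt => /(_ ltac:(lra) e e0) [N _ h]; exists N => n Nn.
by have := h n Nn; rewrite /= sub0r normrN gtr0_norm ?q_gt0.
Qed.

Lemma geometric_cvg (u : nat -> V) :
  (forall n, nrm (u n.+1 - u n) <= q n) ->
  exists l, forall n, nrm (l - u n) <= 4 / 3 * q n.
Proof.
move=> du.
have dist n k : nrm (u (n + k)%N - u n) <= 4 / 3 * (q n - q (n + k)).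
  elim: k => [|k IH]; first by rewrite addn0 !subrr mulr0 ip_norm0.
  apply: le_trans (ip_norm_trans sg (u (n + k)%N) _ _) _.
  rewrite addnS; apply: le_trans (lerD (du _) IH) _.
  by rewrite exprS; lra.
have dist' n k : nrm (u (n + k)%N - u n) <= 4 / 3 * q n.
  by apply: le_trans (dist n k) _; have := q_gt0 (n + k); lra.
have [|l hl] := cg (u := u).
  move=> e e0; have [|N hN] := q_small (e := e / 4); first by lra.
  exists N => m n Nm Nn.
  apply: le_lt_trans (ip_norm_trans sg (u N) _ _) _.
  rewrite [X in _ + X]ip_norm_subC //.
  rewrite -(subnKC Nm) -(subnKC Nn).
  have := dist' N (m - N)%N; have := dist' N (n - N)%N.
  by have := hN N (leqnn _); lra.
exists l => n; apply/ler_addgt0Pr => e e0.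
have [N hN] := hl e e0; have := hN (n + N)%N (leq_addl _ _).
have := dist' n N; rewrite ip_norm_subC // => d1 d2.
apply: le_trans (ip_norm_trans sg (u (n + N)%N) _ _) _.
by rewrite [X in X + _]ip_norm_subC //; move: d1; rewrite ip_norm_subC //; lra.
Qed.

(** The gliding hump: a vector [y] whose inner product with the [n]-th unit
    vector is never smaller than [4^-n / 6].  At stage [n] the correction
    [4^-n *: x n] is added exactly when the inner product reached so far is too
    small, and the total of all later corrections is at most [4^-n / 3]. *)
Lemma gliding_hump (x : nat -> V) : (forall n, nrm (x n) = 1) ->
  exists y, forall n, q n / 6 <= normc (g (x n) y).
Proof.
move=> x1.
pose step n y := if normc (g (x n) y) < q n / 2 then y + (q n)%:C%C *: x n else y.
pose u := fix u n := if n is m.+1 then step m (u m) else 0.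
have big n : q n / 2 <= normc (g (x n) (u n.+1)).
  rewrite /= /step; case: ltP => // small.
  rewrite hermDr // hermZr // conjc_real (herm_real hg) -(sqr_ip_norm sg) x1.
  rewrite expr1n addrC mulr1.
  apply: le_trans (ler_distc _ _).
  by rewrite normc_real ger0_norm ?ltW ?q_gt0 //; lra.
have du n : nrm (u n.+1 - u n) <= q n.
  rewrite /= /step; case: ltP => _; last by rewrite subrr ip_norm0 // ltW ?q_gt0.
  by rewrite addrC addKr ip_normZ // x1 mulr1 normc_real ger0_norm // ltW ?q_gt0.
have [y hy] := geometric_cvg du; exists y => n.
have -> : y = u n.+1 + (y - u n.+1) by rewrite addrC subrK.
rewrite hermDr //; apply: le_trans (ler_distc _ _).
have := le_trans (cauchy_schwarz sg (x n) (y - u n.+1)) _.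
move=> /(_ (4 / 3 * q n.+1)); rewrite x1 mul1r => /(_ (hy _)).
by have := big n; rewrite exprS; lra.
Qed.

(** The uniform boundedness principle, with the bound on the functionals
    [g (v w)] measured by an arbitrary nonnegative gauge [N].  If no constant
    works, there are unit vectors whose gauge decreases faster than [4^-n], and
    the vector given by the gliding hump violates its pointwise bound. *)
Lemma uniform_boundedness (W : Type) (v : W -> V) (N : W -> R) :
  (forall w, 0 <= N w) ->
  (forall y, exists C, forall w, normc (g (v w) y) <= C * N w) ->
  exists2 C : R, 0 < C & forall w, nrm (v w) <= C * N w.
Proof.
move=> N0 hN; apply: contrapT => hC.
have /choice[w hw] n : exists w, (n.+1%:R / q n) * N w < nrm (v w).
  apply: contrapT => h; apply: hC; exists (n.+1%:R / q n).
    by rewrite divr_gt0 // q_gt0.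
  move=> w; rewrite leNgt; apply/negP => lt; apply: h; by exists w.
have npos n : 0 < nrm (v (w n)).
  by apply: le_lt_trans (hw n); rewrite mulr_ge0 // divr_ge0 // ltW // q_gt0.
have [|y hy] := gliding_hump (x := fun n => ((nrm (v (w n)))^-1)%:C%C *: v (w n)).
  move=> n; rewrite ip_normZ // normc_real ger0_norm ?invr_ge0 ?ip_norm_ge0 //.
  by rewrite mulVf // gt_eqF.
have [C hC'] := hN y.
have bnd n : n.+1%:R <= 6 * `|C|.
  have := hy n; rewrite hermZl // normcM normc_real ger0_norm ?invr_ge0 ?ip_norm_ge0 //.
  have h1 : normc (g (v (w n)) y) <= `|C| * N (w n).
    by apply: le_trans (hC' _) _; rewrite ler_wpM2r // ler_norm.
  have h2 : N (w n) <= nrm (v (w n)) * q n / n.+1%:R.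
    rewrite ler_pdivlMr // mulrC -ler_pdivrMr ?q_gt0 // mulrAC; exact: ltW.
  have h3 : normc (g (v (w n)) y) <= nrm (v (w n)) * (`|C| * q n / n.+1%:R).
    apply: le_trans h1 _; apply: le_trans (ler_wpM2l (normr_ge0 _) h2) _.
    by rewrite le_eqVlt; apply/orP; left; apply/eqP; ring.
  rewrite -(ler_pM2l (npos n)) mulVKf ?gt_eqF // => h4.
  have := le_trans h4 h3; rewrite ler_pM2l //.
  rewrite ler_pdivlMr // -[leRHS]mulr1.
  have := q_gt0 n; move: (q n) (n.+1%:R) => a b a0 h5.
  have {}h5 : a * (b / 6) <= a * `|C| by rewrite mulr1 in h5; lra.
  by move: h5; rewrite ler_pM2l //; lra.
have := archi_boundP (x := 6 * `|C|); rewrite mulr_ge0 // => /(_ isT).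
move: (Num.bound _) => n lt; have := bnd n.
by rewrite leNgt (lt_trans lt) // ltr_nat.
Qed.

End UniformBoundedness.

(** * Unconditional sums and Bessel families *)

Section FiniteSums.
Context {R : realType} {I : choiceType}.
Local Open Scope fset_scope.
Local Open Scope ring_scope.

Lemma sum_fset_subset (M : zmodType) (A B : {fset I}) (F : I -> M) : A `<=` B ->
  \sum_(i <- B) F i = \sum_(i <- A) F i + \sum_(i <- B `\` A) F i.
Proof.
move=> AB; rewrite (big_fsetID _ (mem A)) /=.
congr (_ + _); apply: eq_fbigl => i; rewrite !inE //=.
  by apply/andP/idP => [[]//|iA]; split=> //; exact: (fsubsetP AB).
by rewrite andbC.
Qed.

(** The quadratic polynomial in [t] is the sum of the [(x i - t * b * y i) ^+ 2],
    with [b] the sum of the products. *)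
Lemma sum_cauchy_schwarz (r : seq I) (x y : I -> R) :
  (\sum_(i <- r) x i * y i) ^+ 2 <=
  (\sum_(i <- r) x i ^+ 2) * (\sum_(i <- r) y i ^+ 2).
Proof.
apply: discriminant_le => [||t]; first exact: sqr_ge0.
  by apply: sumr_ge0 => i _; exact: sqr_ge0.
set b := \sum_(i <- r) x i * y i.
have : 0 <= \sum_(i <- r) (x i - t * b * y i) ^+ 2.
  by apply: sumr_ge0 => i _; exact: sqr_ge0.
congr (0 <= _).
transitivity (\sum_(i <- r) (x i ^+ 2 - 2 * t * b * (x i * y i)
    + t ^+ 2 * b ^+ 2 * y i ^+ 2)); first by apply: eq_bigr => i _; ring.
rewrite !big_split /= sumrN -!mulr_sumr -/b; ring.
Qed.

Lemma normc_sum (r : seq I) (F : I -> R[i]) :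
  normc (\sum_(i <- r) F i) <= \sum_(i <- r) normc (F i).
Proof.
elim/big_ind2: _ => [|x1 x2 y1 y2 h1 h2|//]; first by rewrite normc0.
exact: le_trans (le_normcD _ _) (lerD h1 h2).
Qed.

Lemma normc_sumM_le (r : seq I) (x y : I -> R[i]) (a b : R) : 0 <= a -> 0 <= b ->
  \sum_(i <- r) normc (x i) ^+ 2 <= a ^+ 2 ->
  \sum_(i <- r) normc (y i) ^+ 2 <= b ^+ 2 ->
  normc (\sum_(i <- r) x i * y i) <= a * b.
Proof.
move=> a0 b0 hx hy; apply: le_trans (normc_sum _ _) _.
rewrite -(@ler_pXn2r _ 2) ?nnegrE ?mulr_ge0 ?sumr_ge0 //.
under eq_bigr do rewrite normcM.
apply: le_trans (sum_cauchy_schwarz _ _ _) _.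
rewrite exprMn; apply: ler_pM => //; apply: sumr_ge0 => i _; exact: sqr_ge0.
Qed.

(** Stated with finite partial sums, the form in which the Bessel estimates
    produce and consume it; [ell2P] gives the link with [ell2]. *)
Definition sq_summable (x : I -> R[i]) : Prop :=
  exists c : R, forall A : {fset I}, \sum_(i <- A) normc (x i) ^+ 2 <= c.

Lemma sq_summable_sqr (x : I -> R[i]) : sq_summable x ->
  exists2 c : R, 0 <= c &
    forall A : {fset I}, \sum_(i <- A) normc (x i) ^+ 2 <= c ^+ 2.
Proof.
case=> c hc; exists (Num.sqrt c) => [|A]; first exact: sqrtr_ge0.
have c0 : 0 <= c by have := hc fset0; rewrite big_seq_fset0.
by rewrite sqr_sqrtr.
Qed.

Lemma esum_leP (m : I -> R) (c : R) : (forall i, 0 <= m i) ->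
  (\esum_(i in [set: I]) (m i)%:E <= c%:E)%E <->
  forall A : {fset I}, \sum_(i <- A) m i <= c.
Proof.
move=> m0; split=> [h A|h].
  rewrite -lee_fin -sumEFin; apply: le_trans h; apply: ereal_sup_ubound.
  exists [set` A]; first by split=> //; exact: finite_fset.
  by rewrite fsbig_finite ?set_fsetK //; exact: finite_fset.
apply: ge_ereal_sup => _ [X [finX _] <-].
by rewrite fsbig_finite // sumEFin lee_fin.
Qed.

Lemma ell2P (x : I -> R[i]) : ell2 x <-> sq_summable x.
Proof.
have m0 i : 0 <= normc (x i) ^+ 2 by exact: sqr_ge0.
rewrite /ell2 /=; split=> [|[c /(esum_leP _ m0) hc]]; last first.
  by apply: le_lt_trans hc _; exact: ltry.
have : (0 <= \esum_(i in [set: I]) (normc (x i) ^+ 2)%:E)%E.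
  by apply: esum_ge0 => i _; rewrite lee_fin.
case E : (\esum_(i in [set: I]) _)%E => [s| |] // _ _.
by exists s; apply/(esum_leP _ m0); rewrite E.
Qed.

End FiniteSums.

Section Sums.
Context {R : realType} {V : lmodType R[i]} (g : V -> V -> R[i]).
Local Notation nrm := (ip_norm g).
Context {I : choiceType}.
Implicit Types (u f : I -> V) (P : pred I) (A B : {fset I}).
Local Open Scope fset_scope.
Local Open Scope ring_scope.

Definition restrict_fam P u : I -> V := fun i => if P i then u i else 0.

Definition sums_to u (v : V) : Prop :=
  forall e : R, 0 < e -> exists A, forall B, A `<=` B ->
    nrm (\sum_(i <- B) u i - v) < e.

(** Families indexed by a subset are handled by extending them by zero. *)
Lemma has_sumP P u v : has_sum g P u v <-> sums_to (restrict_fam P u) v.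
Proof.
have totF : ProperFilter (@totally I) := totally_filter.
rewrite /has_sum; split=> [/(@cvgrPdist_lt _ _ _ _ totF) h e e0|h].
  have [A _ hA] := h e e0; exists A => B AB.
  have := hA B AB; rewrite /= sub0r normrN ger0_norm ?ip_norm_ge0 //.
  by rewrite big_mkcond.
apply/cvgrPdist_lt => e e0; have [A hA] := h e e0; exists A => // B AB.
rewrite /= sub0r normrN ger0_norm ?ip_norm_ge0 // big_mkcond /=; exact: hA.
Qed.

Section SemiNorm.
Context (sg : semi_inner_product g).
Let hg : hermitian_fun g := sg.1.

Lemma sums_to_ip u v x : sums_to u v -> forall e : R, 0 < e ->
  exists A, forall B, A `<=` B ->
    normc (\sum_(i <- B) g x (u i) - g x v) < e.
Proof.
move=> h e e0; have x1 : 0 < nrm x + 1 by have := ip_norm_ge0 g x; lra.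
have [|A hA] := h (e / (nrm x + 1)); first by rewrite divr_gt0.
exists A => B /hA; rewrite -herm_sumr // -hermBr // => lt.
apply: le_lt_trans (cauchy_schwarz sg _ _) _.
rewrite ltr_pdivlMr // in lt; apply: le_lt_trans lt.
by rewrite mulrC ler_wpM2l ?ip_norm_ge0 // lerDl.
Qed.

(** An inner product with a sum inherits every bound satisfied by the inner
    products with the large partial sums. *)
Lemma sums_to_ip_le u v x (z : R[i]) c A0 : sums_to u v ->
  (forall B, A0 `<=` B -> normc (\sum_(i <- B) g x (u i) - z) <= c) ->
  normc (g x v - z) <= c.
Proof.
move=> h hc; apply/ler_addgt0Pr => e e0; have [A hA] := sums_to_ip x h e0.
have h1 := hA _ (fsubsetUl A A0); have h2 := hc _ (fsubsetUr A A0).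
set s := \sum_(i <- _) _ in h1 h2.
have -> : g x v - z = (s - z) + - (s - g x v) by ring.
apply: le_trans (le_normcD _ _) _; rewrite normcN; apply: lerD => //; exact: ltW.
Qed.

(** Completeness is sequential, so a sequence of finite index sets is extracted
    along which the partial sums converge. *)
Lemma net_cauchy_sums_to u : complete_ip g ->
  (forall e : R, 0 < e -> exists A, forall B, A `<=` B ->
    nrm (\sum_(i <- B) u i - \sum_(i <- A) u i) < e) ->
  exists v, sums_to u v.
Proof.
move=> cg h; pose S A := \sum_(i <- A) u i.
have /choice[A hA] n : exists A, forall B, A `<=` B -> nrm (S B - S A) < n.+1%:R^-1.
  by apply: h; rewrite invr_gt0.
have archi (e : R) : 0 < e -> exists N, forall n, (N <= n)%N -> n.+1%:R^-1 < e.
  move=> e0; exists (Num.bound e^-1) => n Nn; rewrite invf_plt ?posrE //.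
  apply: lt_le_trans (archi_boundP _) _; first by rewrite invr_ge0 ltW.
  by rewrite ler_nat leqW.
have [|v hv] := cg (fun n => S (A n)).
  move=> e e0; have [|N hN] := archi (e / 2); first by rewrite divr_gt0.
  exists N => m n Nm Nn; apply: le_lt_trans (ip_norm_trans sg (S (A m `|` A n)) _ _) _.
  rewrite [X in X + _]ip_norm_subC //.
  have := lt_trans (hA m _ (fsubsetUl _ (A n))) (hN m Nm).
  by have := lt_trans (hA n _ (fsubsetUr (A m) _)) (hN n Nn); lra.
exists v => e e0; have [|N hN] := archi (e / 2); first by rewrite divr_gt0.
have [|M hM] := hv (e / 2); first by rewrite divr_gt0.
exists (A (maxn N M)) => B AB.
apply: le_lt_trans (ip_norm_trans sg (S (A (maxn N M))) _ _) _.
have := lt_trans (hA _ _ AB) (hN _ (leq_maxl _ _)).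
by have := hM _ (leq_maxr N M); rewrite -/(S B); lra.
Qed.

(** Vanishing of the tails: a partial sum within [e] of the supremum leaves less
    than [e] for all other indices. *)
Lemma summable_tail (m : I -> R) c : (forall i, 0 <= m i) ->
  (forall A, \sum_(i <- A) m i <= c) -> forall e : R, 0 < e ->
  exists A, forall B, A `<=` B -> \sum_(i <- B `\` A) m i < e.
Proof.
move=> m0 hc e e0; pose E := [set \sum_(i <- A) m i | A in [set: {fset I}]].
have ubE : has_ubound E by exists c => _ [A _ <-].
have [|_ [A _ <-] hA] := sup_adherent (E := E) e0.
  by split=> //; exists (\sum_(i <- fset0) m i); exists fset0.
exists A => B AB; have : \sum_(i <- B) m i <= sup E.
  by apply: ub_le_sup => //; exists B.
by rewrite (sum_fset_subset _ AB); lra.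
Qed.

End SemiNorm.

Section InnerProduct.
Context (ig : inner_product g).
Let sg : semi_inner_product g := ig.1.
Let hg : hermitian_fun g := sg.1.

Lemma sums_to_unique u v w : sums_to u v -> sums_to u w -> v = w.
Proof.
move=> hv hw; apply/eqP; rewrite -subr_eq0; apply/eqP.
apply: (ip_norm_eq0 ig); apply/eqP; rewrite eq_le ip_norm_ge0 andbT.
apply/ler_addgt0Pr => e e0; rewrite add0r.
have [|A hA] := hv (e / 2); first by rewrite divr_gt0.
have [|B hB] := hw (e / 2); first by rewrite divr_gt0.
have h1 := hA _ (fsubsetUl A B); have h2 := hB _ (fsubsetUr A B).
apply: le_trans (ip_norm_trans sg (\sum_(i <- A `|` B) u i) _ _) _.
by rewrite [X in X + _]ip_norm_subC //; lra.
Qed.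

Lemma usumE P u v : sums_to (restrict_fam P u) v -> usum g P u = v.
Proof.
move=> h; apply: xget_unique; first exact/has_sumP.
by move=> w /has_sumP hw; exact: sums_to_unique hw h.
Qed.

End InnerProduct.

Section BesselFamilies.
Context (ig : inner_product g) (cg : complete_ip g).
Let sg : semi_inner_product g := ig.1.
Let hg : hermitian_fun g := sg.1.

(** The operator norm of the analysis operator is at most [b]. *)
Definition bessel_bound f (b : R) : Prop :=
  forall x A, \sum_(i <- A) normc (g x (f i)) ^+ 2 <= (b * nrm x) ^+ 2.

(** The synthesis operator is the adjoint of the analysis operator, so it has
    the same bound. *)
Lemma bessel_synthesis_bound f b : 0 <= b -> bessel_bound f b ->
  forall (a : I -> R[i]) A,
  nrm (\sum_(i <- A) a i *: f i) ^+ 2 <=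
  b ^+ 2 * \sum_(i <- A) normc (a i) ^+ 2.
Proof.
move=> b0 hb a A; set v := \sum_(i <- A) _; set s := \sum_(i <- A) _.
have s0 : 0 <= s by apply: sumr_ge0 => i _; exact: sqr_ge0.
have : nrm v ^+ 2 <= Num.sqrt s * (b * nrm v).
  rewrite (sqr_ip_norm sg) {1}/v herm_suml //.
  apply: le_trans (Re_le_normc _) _.
  under eq_bigr do rewrite hermZl //.
  apply: normc_sumM_le; rewrite ?sqrtr_ge0 ?mulr_ge0 ?ip_norm_ge0 ?sqr_sqrtr //.
  under eq_bigr do rewrite normc_hermC //; exact: hb.
have [-> _|v_neq0 h] := eqVneq (nrm v) 0; first by rewrite expr0n /= mulr_ge0 ?sqr_ge0.
have vpos : 0 < nrm v by rewrite lt_def v_neq0 ip_norm_ge0.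
rewrite expr2 mulrA ler_pM2r // in h.
apply: (@le_trans _ _ ((Num.sqrt s * b) ^+ 2)).
  by rewrite ler_pXn2r ?nnegrE ?mulr_ge0 ?sqrtr_ge0.
by rewrite exprMn sqr_sqrtr // mulrC.
Qed.

Lemma bessel_sums_to f b (a : I -> R[i]) : 0 <= b -> bessel_bound f b ->
  sq_summable a -> exists v, sums_to (fun i => a i *: f i) v.
Proof.
move=> b0 hb [c hc]; apply: (net_cauchy_sums_to sg cg) => e e0.
have b1 : 0 < b ^+ 2 + 1 by have := sqr_ge0 b; lra.
have [|||A hA] := @summable_tail (fun i => normc (a i) ^+ 2) c _ _
    (e ^+ 2 / (b ^+ 2 + 1)) => //.
- by move=> i; exact: sqr_ge0.
- by rewrite divr_gt0 ?exprn_gt0.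
exists A => B AB; rewrite (sum_fset_subset _ AB) addrC addKr.
rewrite -(@ltr_pXn2r _ 2) ?nnegrE ?ip_norm_ge0 ?ltW //.
apply: le_lt_trans (bessel_synthesis_bound b0 hb _ _) _.
have := hA _ AB; rewrite ltr_pdivlMr // => lt; apply: le_lt_trans lt.
rewrite mulrC ler_wpM2l ?lerDl //.
by apply: sumr_ge0 => i _; exact: sqr_ge0.
Qed.

Lemma bessel_sq_summable f b x : bessel_bound f b ->
  sq_summable (fun i => g x (f i)).
Proof. by move=> hb; exists ((b * nrm x) ^+ 2); exact: hb. Qed.

Lemma bessel_restrict P f b : bessel_bound f b -> bessel_bound (restrict_fam P f) b.
Proof.
move=> hb x A; apply: le_trans (hb x A); apply: ler_sum => i _.
rewrite /restrict_fam; case: ifP => // _.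
by rewrite herm0r // normc0 expr0n /= sqr_ge0.
Qed.

End BesselFamilies.

End Sums.

Lemma sums_to_map (R : realType) (V W : lmodType R[i]) (I : choiceType)
    (g : V -> V -> R[i]) (h : W -> W -> R[i]) (T : V -> W) (M : R)
    (u : I -> V) v : linear T -> 0 <= M ->
  (forall x, ip_norm h (T x) <= M * ip_norm g x) ->
  sums_to g u v -> sums_to h (T \o u) (T v).
Proof.
move=> linT M0 hT hu e e0; have M1 : 0 < M + 1 by lra.
have TB x y : T (x - y) = T x - T y.
  by have := linT (-1) y x; rewrite !scaleN1r ![- _ + _]addrC.
have TD x y : T (x + y) = T x + T y by have := linT 1 x y; rewrite !scale1r.
have T0 : T 0 = 0 by have := TB 0 0; rewrite !subrr.
have [|A hA] := hu (e / (M + 1)); first by rewrite divr_gt0.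
exists A => B /hA; rewrite -(big_morph T TD T0) -TB ltr_pdivlMr // => lt.
apply: le_lt_trans (hT _) _; apply: le_lt_trans lt.
by rewrite mulrC ler_wpM2l ?ip_norm_ge0 // lerDl.
Qed.

Lemma eq_sums_to (R : realType) (V : lmodType R[i]) (I : choiceType)
    (g : V -> V -> R[i]) (u u' : I -> V) v :
  u =1 u' -> sums_to g u v -> sums_to g u' v.
Proof. by move=> /funext ->. Qed.

(** * Orthonormal bases and the Riesz representation *)

Section OrthonormalFamilies.
Context {R : realType} {V : lmodType R[i]} (g : V -> V -> R[i]).
Context (ig : inner_product g).
Let sg : semi_inner_product g := ig.1.
Let hg : hermitian_fun g := sg.1.
Local Notation nrm := (ip_norm g).

Lemma maximal_orthonormal_set : exists B : set V,
  [/\ forall x, B x -> g x x = 1,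
      forall x y, B x -> B y -> x <> y -> g x y = 0 &
      forall x, (forall y, B y -> g x y = 0) -> x = 0].
Proof.
pose P : set (set V) := [set B | (forall x, B x -> g x x = 1) /\
  (forall x y, B x -> B y -> x <> y -> g x y = 0)].
have [F FP totF|B [[B1 B2] maxB]] := @Zorn_bigcup V P.
  split=> [x [X FX Xx]|x y [X FX Xx] [Y FY Yy]]; first exact: (FP _ FX).1.
  have [XY|YX] := totF _ _ FX FY.
    exact: (FP _ FY).2 (XY _ Xx) Yy.
  exact: (FP _ FX).2 Xx (YX _ Yy).
exists B; split=> // x xB; apply: contrapT => /eqP x_neq0.
have n_neq0 : nrm x != 0.
  by apply: contra_neq x_neq0 => /(ip_norm_eq0 ig).
pose y := ((nrm x)^-1)%:C%C *: x.
have yy : g y y = 1.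
  rewrite (herm_real hg) Re_hermZ // normc_real real_normK ?num_real //.
  by rewrite -(sqr_ip_norm sg) -exprMn mulVf // expr1n.
have yB z : B z -> g y z = 0 by move=> /xB h; rewrite hermZl // h mulr0.
apply: (maxB (y |` B)); last first.
  split=> [z [->//|/B1//]|z w [->|Bz] [->|Bw] zw] //.
  - exact: yB.
  - by rewrite herm_conj // yB // conjc0.
  - exact: B2.
split; first by move=> z Bz; right.
move=> /(_ y (or_introl erefl)) By.
by have := yB _ By; rewrite yy => /eqP; rewrite oner_eq0.
Qed.

Section Families.
Context {I : choiceType}.
Implicit Types (e : I -> V) (A : {fset I}).

(** Zero vectors are allowed, so that a basis can be indexed by a larger type. *)
Definition orthonormal_family e : Prop :=
  (forall i j, i != j -> g (e i) (e j) = 0) /\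
  (forall i, e i = 0 \/ g (e i) (e i) = 1).

Lemma orthonormal_coef e (c : I -> R[i]) A j : orthonormal_family e ->
  j \in A -> g (\sum_(i <- A) c i *: e i) (e j) = c j * g (e j) (e j).
Proof.
move=> [eO _] jA; rewrite herm_suml // (big_fsetD1 j) //= hermZl //.
rewrite big1_fset ?addr0 // => i; rewrite !inE => /andP[ij _] _.
by rewrite hermZl // eO // mulr0.
Qed.

(** Bessel's inequality, from [0 <= |x - s|^2] for the partial expansion [s]. *)
Lemma orthonormal_bessel e : orthonormal_family e -> bessel_bound g e 1.
Proof.
move=> oe x A; rewrite mul1r.
pose s := \sum_(i <- A) g x (e i) *: e i.
set b := \sum_(i <- A) _.
have coef j : j \in A -> g s (e j) = g x (e j).
  move=> jA; rewrite /s orthonormal_coef //.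
  by case: (oe.2 j) => ->; rewrite ?mulr1 // !(herm0r hg) mulr0.
have bE (y : V) : (forall j, j \in A -> g y (e j) = g x (e j)) -> Re (g y s) = b.
  move=> hy; rewrite /s herm_sumr // (big_morph (fun c : R[i] => Re c) ReD erefl).
  rewrite /b !big_seq; apply: eq_bigr => i iA.
  by rewrite hermZr // hy // mulrC mulc_conj.
have := sg.2 (x - s); rewrite Re_hermD // Re_hermN // hermNr // ReN.
rewrite (bE x) // (bE s) //; have := sqr_ip_norm sg x; lra.
Qed.

Lemma orthonormal_expansion e x : complete_ip g -> orthonormal_family e ->
  (forall x, (forall i, g x (e i) = 0) -> x = 0) ->
  sums_to g (fun i => g x (e i) *: e i) x.
Proof.
move=> cg oe total.
have [|v hv] := bessel_sums_to ig cg ler01 (orthonormal_bessel oe)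
  (a := fun i => g x (e i)).
  exact: bessel_sq_summable (orthonormal_bessel oe).
suff xv : x = v by rewrite -xv in hv.
apply/eqP; rewrite -subr_eq0; apply/eqP; apply: total => j.
suff : normc (g (e j) v - g (e j) x) <= 0.
  move=> h; rewrite herm_conj // hermBr // -opprB.
  suff -> : g (e j) v - g (e j) x = 0 by rewrite oppr0 conjc0.
  by apply: eq0_normc; apply/eqP; rewrite eq_le h normc_ge0.
apply: (sums_to_ip_le sg (A0 := [fset j]%fset) hv) => B /fsubsetP jB.
have {}jB : j \in B by apply: jB; rewrite inE.
rewrite -herm_sumr // -hermBr // herm_conj // hermBl // orthonormal_coef //.
have -> : g x (e j) * g (e j) (e j) - g x (e j) = 0.
  by case: (oe.2 j) => ->; rewrite ?mulr1 ?subrr // !(herm0r hg) mulr0 subrr.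
by rewrite conjc0 normc0.
Qed.

(** The basis is indexed by any type in which every vector has exactly one index;
    this lets two bases of different spaces share one index type. *)
Lemma orthonormal_basis_exists (k : I -> option V) : complete_ip g ->
  (forall v, exists i, k i = Some v) ->
  (forall i j v, k i = Some v -> k j = Some v -> i = j) ->
  exists e, [/\ orthonormal_family e, forall i, k i = None -> e i = 0 &
    forall x, sums_to g (fun i => g x (e i) *: e i) x].
Proof.
move=> cg ksurj kinj; have [B [B1 B2 Btotal]] := maximal_orthonormal_set.
pose e i := if k i is Some v then (if `[< B v >] then v else 0) else 0.
have eP i : e i = 0 \/ k i = Some (e i) /\ B (e i).
  rewrite /e; case: (k i) => [v|]; last by left.
  by case: asboolP => Bv; [right|left].
have oe : orthonormal_family e.
  split=> [i j ij|i]; last by case: (eP i) => [|[_ /B1]]; [left|right].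
  case: (eP i) => [->|[ki Bi]]; first by rewrite herm0l.
  case: (eP j) => [->|[kj Bj]]; first by rewrite herm0r.
  apply: B2 => // eij; move/eqP: ij; apply.
  by apply: kinj ki _; rewrite eij.
exists e; split=> // [i|x]; first by rewrite /e => ->.
apply: orthonormal_expansion => // y hy; apply: Btotal => v Bv.
have [i ki] := ksurj v.
by have := hy i; rewrite /e ki; case: asboolP.
Qed.

End Families.

(** Riesz representation.  The representing vector is
    [\sum_i (phi (e i))^* e i] for an orthonormal basis [e]. *)
Lemma riesz (cg : complete_ip g) (phi : V -> R[i]) (M : R) :
  (forall a x y, phi (a *: x + y) = a * phi x + phi y) -> 0 <= M ->
  (forall x, normc (phi x) <= M * nrm x) ->
  exists z, forall x, phi x = g x z.
Proof.
move=> phiL M0 hM.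
have phiD x y : phi (x + y) = phi x + phi y.
  by have := phiL 1 x y; rewrite scale1r mul1r.
have phi0 : phi 0 = 0.
  by apply: (@addrI _ (phi 0)); rewrite -phiD !addr0.
have phiZ a x : phi (a *: x) = a * phi x.
  by have := phiL a x 0; rewrite !addr0 phi0 addr0.
have phiB x y : phi (x - y) = phi x - phi y.
  by rewrite phiD -scaleN1r phiZ mulN1r.
have [|i j v [->] [->]//|e [oe _ expand]] :=
    orthonormal_basis_exists (k := @Some V) cg; first by move=> v; exists v.
have bess := orthonormal_bessel oe.
have phisum (A : {fset V}) (c : V -> R[i]) :
    phi (\sum_(i <- A) c i *: e i) = \sum_(i <- A) c i * phi (e i).
  by rewrite (big_morph phi phiD phi0); apply: eq_bigr => i _; rewrite phiZ.
(* the square sum b equals phi s <= M |s| <= M sqrt b, hence b <= M^2 *)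
have summ : sq_summable (fun i => conjc (phi (e i))).
  exists (M ^+ 2) => A; set b := \sum_(i <- A) _.
  have b0 : 0 <= b by apply: sumr_ge0 => i _; exact: sqr_ge0.
  pose s := \sum_(i <- A) conjc (phi (e i)) *: e i.
  have sE : phi s = b%:C%C.
    rewrite phisum; apply/esym.
    rewrite /b (big_morph (real_complex R) (@rmorphD _ _ _) (rmorph0 _)).
    by apply: eq_bigr => i _; rewrite mulrC mulc_conj normc_conj.
  have h1 : b <= M * nrm s by rewrite -(ger0_norm b0) -normc_real -sE.
  have h2 : nrm s ^+ 2 <= b.
    by have := bessel_synthesis_bound ig ler01 bess (fun i => conjc (phi (e i))) A;
      rewrite expr1n mul1r.
  have h3 : b ^+ 2 <= M ^+ 2 * b.
    apply: (@le_trans _ _ ((M * nrm s) ^+ 2)).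
      by rewrite ler_pXn2r ?nnegrE ?mulr_ge0 ?ip_norm_ge0.
    by rewrite exprMn ler_wpM2l ?sqr_ge0.
  have [->|b_neq0] := eqVneq b 0; first exact: sqr_ge0.
  by rewrite expr2 ler_pM2r // in h3; rewrite lt_def b_neq0.
have [z hz] := bessel_sums_to ig cg ler01 bess summ.
exists z => x; apply/eqP; rewrite -subr_eq0 -oppr_eq0 opprB; apply/eqP.
apply: eq0_normc; apply/eqP; rewrite eq_le normc_ge0 andbT.
apply/ler_addgt0Pr => d d0; rewrite add0r.
have M1 : 0 < M + 1 by lra.
have [|A hA] := expand x (d / (M + 1)); first by rewrite divr_gt0.
apply: (sums_to_ip_le sg (A0 := A) hz) => B /hA lt.
have -> : \sum_(i <- B) g x (conjc (phi (e i)) *: e i) =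
          phi (\sum_(i <- B) g x (e i) *: e i).
  by rewrite phisum; apply: eq_bigr => i _; rewrite hermZr // conjcK mulrC.
rewrite -phiB; apply: le_trans (hM _) _.
rewrite ltr_pdivlMr // in lt; apply: le_trans (ltW lt).
by rewrite mulrC ler_wpM2l ?ip_norm_ge0 // lerDl.
Qed.

End OrthonormalFamilies.

Section CompleteSpace.
Context {R : realType} {V : lmodType R[i]} (g : V -> V -> R[i]).
Context (ig : inner_product g) (cg : complete_ip g).
Let sg : semi_inner_product g := ig.1.
Let hg : hermitian_fun g := sg.1.
Local Notation nrm := (ip_norm g).

(** An everywhere defined symmetric operator is bounded (Hellinger-Toeplitz):
    the functionals [g (T x)] on the unit ball are pointwise bounded, because
    [g (T x) y = g x (T y)]. *)
Lemma symmetric_bounded (T : V -> V) : is_adjoint g g T T ->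
  exists2 M : R, 0 < M & forall x, nrm (T x) <= M * nrm x.
Proof.
move=> symT; apply: (uniform_boundedness ig cg (v := T) (N := nrm)).
  by move=> w; exact: ip_norm_ge0.
move=> y; exists (nrm (T y)) => w; rewrite symT mulrC; exact: cauchy_schwarz.
Qed.

Lemma complete_ip_equiv (h : V -> V -> R[i]) (c c' : R) : 0 < c -> 0 < c' ->
  (forall x, nrm x <= c * ip_norm h x) -> (forall x, ip_norm h x <= c' * nrm x) ->
  complete_ip h.
Proof.
move=> c0 c'0 hc hc' u hu; have [|l hl] := cg (u := u).
  move=> e e0; have [|N hN] := hu (e / c); first by rewrite divr_gt0.
  exists N => m n Nm Nn; apply: le_lt_trans (hc _) _.
  by rewrite mulrC -ltr_pdivlMr //; exact: hN.
exists l => e e0; have [|N hN] := hl (e / c'); first by rewrite divr_gt0.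
exists N => n Nn; apply: le_lt_trans (hc' _) _.
by rewrite mulrC -ltr_pdivlMr //; exact: hN.
Qed.

(** Lax-Milgram for symmetric operators: [g (T x) y] is again a complete inner
    product, and the preimage of [y] is the vector that represents [g^~ y] with
    respect to it. *)
Lemma coercive_surjective (T : {linear V -> V}) (c : R) : is_adjoint g g T T ->
  0 < c -> (forall x, c * nrm x ^+ 2 <= Re (g (T x) x)) ->
  forall y, exists x, T x = y.
Proof.
move=> symT c0 coer y; have [M M0 hM] := symmetric_bounded symT.
pose h x z := g (T x) z.
have h_ge0 x : 0 <= Re (h x x).
  by apply: le_trans (coer x); rewrite mulr_ge0 ?sqr_ge0 // ltW.
have sh : semi_inner_product h.
  split=> //; split=> [a x x' z|x z]; first by rewrite /h linearP hermDl // hermZl.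
  by rewrite /h symT; exact: herm_conj.
have ih : inner_product h.
  split=> // x hx; apply: ig.2; have := coer x.
  rewrite -/(h x x) hx (sqr_ip_norm sg) pmulr_rle0 // => le0.
  by apply/eqP; rewrite eq_le le0 sg.2.
pose s := Num.sqrt c.
have s0 : 0 < s by rewrite sqrtr_gt0.
have gh x : nrm x <= s^-1 * ip_norm h x.
  rewrite mulrC ler_pdivlMr // -(@ler_pXn2r _ 2) ?nnegrE ?mulr_ge0 ?ip_norm_ge0 ?(ltW s0) //.
  by rewrite exprMn (sqr_sqrtr (ltW c0)) (sqr_ip_norm sh) mulrC; exact: coer.
have hgb x : ip_norm h x <= Num.sqrt M * nrm x.
  apply: ip_norm_le => //; first by rewrite mulr_ge0 ?sqrtr_ge0 ?ip_norm_ge0.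
  rewrite exprMn (sqr_sqrtr (ltW M0)).
  apply: le_trans (Re_le_normc _) _; apply: le_trans (cauchy_schwarz sg _ _) _.
  by rewrite expr2 mulrA ler_wpM2r ?ip_norm_ge0.
have ch : complete_ip h.
  by apply: complete_ip_equiv gh hgb; rewrite ?invr_gt0 ?sqrtr_gt0.
have [|||z hz] := riesz ih ch (phi := g^~ y) (M := s^-1 * nrm y).
- by move=> a x x'; exact: sg.1.1.
- by rewrite mulr_ge0 ?ip_norm_ge0 // invr_ge0 ltW.
- move=> x; apply: le_trans (cauchy_schwarz sg _ _) _.
  by rewrite mulrAC ler_wpM2r ?ip_norm_ge0.
exists z; apply/eqP; rewrite -subr_eq0; apply/eqP; apply: ig.2.
set w := T z - y; rewrite {2}/w (hermBr hg) -symT -/(h w z) -hz subrr.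
by [].
Qed.

End CompleteSpace.

(** * Fundamental decompositions *)

Lemma hilbertP (R : realType) (V : lmodType R[i]) (ip : hermitian_form V) :
  is_hilbert ip <-> inner_product ip /\ complete_ip ip.
Proof.
have hg := hermitian_form_fun ip.
have posE x : (0 < ip x x) = (0 < Re (ip x x)).
  by rewrite ltcE /= (Im_herm hg) eqxx.
have cvgE (u : nat -> V) l : ip_norm ip (u n - l) @[n --> \oo] --> (0 : R) <->
    forall e : R, 0 < e -> exists N, forall n, (N <= n)%N -> ip_norm ip (u n - l) < e.
  split=> [/cvgrPdist_lt h e e0|h].
    have [N _ hN] := h e e0; exists N => n Nn.
    by have := hN n Nn; rewrite /= sub0r normrN ger0_norm ?ip_norm_ge0.
  apply/cvgrPdist_lt => e e0; have [N hN] := h e e0; exists N => // n Nn.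
  by rewrite /= sub0r normrN ger0_norm ?ip_norm_ge0 //; exact: hN.
split=> [[pos compl]|[[[_ psd] def] compl]].
  split; last by move=> u /compl[l /cvgE hl]; exists l.
  split=> [|x]; first split=> // x.
    have [->|/pos] := eqVneq x 0; first by rewrite (herm0l hg).
    by rewrite posE => /ltW.
  by move=> x0; apply: contrapT => /eqP/pos; rewrite posE x0 ltxx.
split; last by move=> u /compl[l hl]; exists l; apply/cvgE.
move=> x x_neq0; rewrite posE lt_def psd andbT.
by apply: contra_neq x_neq0; exact: def.
Qed.

Lemma submodN (R : realType) (H : lmodType R[i]) (L : submodClosed H) x :
  x \in L -> - x \in L.
Proof. by move=> xL; rewrite -scaleN1r rpredZ. Qed.

Lemma submodB (R : realType) (H : lmodType R[i]) (L : submodClosed H) x y :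
  x \in L -> y \in L -> x - y \in L.
Proof. by move=> xL yL; rewrite rpredD ?submodN. Qed.

Lemma subspace_valB (R : realType) (H : lmodType R[i]) (L : submodClosed H)
    (x y : subspace L) : \val (x - y) = \val x - \val y.
Proof. exact: raddfB. Qed.

Definition to_subspace (R : realType) (H : lmodType R[i]) (L : submodClosed H) x
  (xL : x \in L) : subspace L := exist _ x xL.

Section FundamentalDecomposition.
Context {R : realType} {H : lmodType R[i]} (form : hermitian_form H).
Context (Hp Hm : submodClosed H) (fd : fundamental_decomposition form Hp Hm).
Let hf : hermitian_fun form := hermitian_form_fun form.
Local Notation P := (component Hp Hm).
Local Notation Q := (component Hm Hp).
Local Notation ip := (fund_ip form Hp Hm).
Local Notation nrm := (ip_norm ip).

Lemma component_spec x : P x \in Hp /\ x - P x \in Hm.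
Proof.
have [dec _ _ _ _] := fd; have [y [z ->]] := dec x.
apply: (@xgetPex _ 0 [set y0 | y0 \in Hp /\ _ - y0 \in Hm]); exists (\val y).
by split; [exact: (valP y)|rewrite addrC addKr; exact: (valP z)].
Qed.

Lemma component_unique x y z : y \in Hp -> z \in Hm -> x = y + z ->
  P x = y /\ Q x = z.
Proof.
move=> yHp zHm ->; have [_ disj _ _ _] := fd; split; apply: xget_unique => /=.
- by rewrite addrC addKr.
- move=> w [wHp h]; apply/eqP; rewrite -subr_eq0; apply/eqP; apply: disj.
    by rewrite submodB.
  have -> : w - y = z - (y + z - w) by rewrite opprB addrCA opprD (addrC (- y)) addNKr.
  by rewrite submodB.
- by rewrite addrK.
- move=> w [wHm h]; apply/eqP; rewrite -subr_eq0; apply/eqP; apply: disj.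
    have -> : w - z = y - (y + z - w) by rewrite opprB addrCA opprD addNKr.
    by rewrite submodB.
  by rewrite submodB.
Qed.

Lemma component_pos x : P x \in Hp. Proof. by case: (component_spec x). Qed.

Lemma component_sum x : P x + Q x = x.
Proof.
have [h1 h2] := component_spec x.
have [_ ->] := component_unique h1 h2 (esym (subrKC _ _)).
by rewrite subrKC.
Qed.

Lemma component_neg x : Q x \in Hm.
Proof.
have [h1 h2] := component_spec x.
by have [_ ->] := component_unique h1 h2 (esym (subrKC _ _)).
Qed.

Lemma component_in_pos x : x \in Hp -> P x = x /\ Q x = 0.
Proof. by move=> xp; apply: component_unique; rewrite ?rpred0 ?addr0. Qed.

Lemma component_in_neg x : x \in Hm -> P x = 0 /\ Q x = x.
Proof. by move=> xm; apply: component_unique; rewrite ?rpred0 ?add0r. Qed.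

Lemma component_linear a x y :
  P (a *: x + y) = a *: P x + P y /\ Q (a *: x + y) = a *: Q x + Q y.
Proof.
apply: component_unique.
- by rewrite rpredD ?rpredZ ?component_pos.
- by rewrite rpredD ?rpredZ ?component_neg.
- rewrite -{1}(component_sum x) -{1}(component_sum y).
  by rewrite scalerDr addrACA.
Qed.

Definition pos_part (x : H) : subspace Hp := to_subspace (component_pos x).
Definition neg_part (x : H) : subspace Hm := to_subspace (component_neg x).

Lemma pos_part_linear : linear pos_part.
Proof. by move=> a x y; apply: val_inj; rewrite linearP; exact: (component_linear _ _ _).1. Qed.

Lemma neg_part_linear : linear neg_part.
Proof. by move=> a x y; apply: val_inj; rewrite linearP; exact: (component_linear _ _ _).2. Qed.

Lemma pos_part_val (x : subspace Hp) : pos_part (\val x) = x.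
Proof. by apply: val_inj; exact: (component_in_pos (valP x)).1. Qed.

Lemma part_sum x : \val (pos_part x) + \val (neg_part x) = x.
Proof. exact: component_sum. Qed.

Lemma form_pos_neg x y : x \in Hp -> y \in Hm -> form x y = 0.
Proof. by have [_ _ orth _ _] := fd; exact: orth. Qed.

Lemma form_neg_pos x y : x \in Hm -> y \in Hp -> form x y = 0.
Proof. by move=> xm yp; rewrite (herm_conj hf) form_pos_neg // conjc0. Qed.

Lemma pos_form_ip : inner_product (pos_form form Hp).
Proof. by have [_ _ _ /hilbertP[]] := fd. Qed.

Lemma pos_form_complete : complete_ip (pos_form form Hp).
Proof. by have [_ _ _ /hilbertP[]] := fd. Qed.

Lemma neg_form_ip : inner_product (neg_form form Hm).
Proof. by have [_ _ _ _ /hilbertP[]] := fd. Qed.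

Lemma neg_form_complete : complete_ip (neg_form form Hm).
Proof. by have [_ _ _ _ /hilbertP[]] := fd. Qed.

Lemma fund_ipE x y : ip x y =
  pos_form form Hp (pos_part x) (pos_part y) +
  neg_form form Hm (neg_part x) (neg_part y).
Proof. by []. Qed.

Lemma fund_ip_form x y : ip x y = form x (P y - Q y).
Proof.
rewrite -{2}(component_sum x) (hermDl hf) !(hermBr hf).
rewrite (form_pos_neg (component_pos _) (component_neg _)).
rewrite (form_neg_pos (component_neg _) (component_pos _)).
by rewrite subr0 sub0r.
Qed.

Lemma fund_ip_inner_product : inner_product ip.
Proof.
have [[hp psdp] defp] := pos_form_ip; have [[hm psdm] defm] := neg_form_ip.
split; last first.
  move=> x; rewrite fund_ipE ReD => /eqP.
  rewrite paddr_eq0 ?psdp ?psdm // => /andP[/eqP/defp p0 /eqP/defm m0].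
  by rewrite -(part_sum x) p0 m0 addr0.
split; last by move=> x; rewrite fund_ipE ReD addr_ge0.
split=> [a x y z|x y]; rewrite !fund_ipE; last first.
  by rewrite (herm_conj hp) (herm_conj hm) conjcD.
rewrite pos_part_linear neg_part_linear hp.1 hm.1; ring.
Qed.

Let sip : semi_inner_product ip := fund_ip_inner_product.1.

Lemma sqr_fund_norm x : nrm x ^+ 2 =
  ip_norm (pos_form form Hp) (pos_part x) ^+ 2 +
  ip_norm (neg_form form Hm) (neg_part x) ^+ 2.
Proof.
rewrite (sqr_ip_norm sip) (sqr_ip_norm pos_form_ip.1).
by rewrite (sqr_ip_norm neg_form_ip.1) fund_ipE ReD.
Qed.

Lemma fund_norm_pos (x : subspace Hp) :
  nrm (\val x) = ip_norm (pos_form form Hp) x.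
Proof.
have [px qx] := component_in_pos (valP x).
by rewrite /ip_norm /fund_ip px qx (herm0r hf) subr0.
Qed.

Lemma fund_norm_neg (x : subspace Hm) :
  nrm (\val x) = ip_norm (neg_form form Hm) x.
Proof.
have [px qx] := component_in_neg (valP x).
by rewrite /ip_norm /fund_ip px qx (herm0r hf) sub0r.
Qed.

Lemma pos_part_norm_le x : ip_norm (pos_form form Hp) (pos_part x) <= nrm x.
Proof.
by rewrite -(@ler_pXn2r _ 2) ?nnegrE ?ip_norm_ge0 // sqr_fund_norm lerDl sqr_ge0.
Qed.

Lemma neg_part_norm_le x : ip_norm (neg_form form Hm) (neg_part x) <= nrm x.
Proof.
by rewrite -(@ler_pXn2r _ 2) ?nnegrE ?ip_norm_ge0 // sqr_fund_norm lerDr sqr_ge0.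
Qed.

Lemma symmetry_norm x : nrm (P x - Q x) = nrm x.
Proof.
have [px qx] : P (P x - Q x) = P x /\ Q (P x - Q x) = - Q x.
  by apply: component_unique; rewrite ?submodN ?component_pos ?component_neg.
by rewrite /ip_norm /fund_ip px qx (hermNl hf) (hermNr hf) opprK.
Qed.

Lemma form_bounded x y : normc (form x y) <= nrm x * nrm y.
Proof.
have -> : form x y = ip x (P y - Q y).
  rewrite fund_ip_form; congr (form x _).
  have [-> ->] : P (P y - Q y) = P y /\ Q (P y - Q y) = - Q y.
    by apply: component_unique; rewrite ?submodN ?component_pos ?component_neg.
  by rewrite opprK component_sum.
by rewrite -(symmetry_norm y); exact: cauchy_schwarz.
Qed.

Lemma fund_ip_complete : complete_ip ip.
Proof.
move=> u hu.
have pB x y : pos_part (x - y) = pos_part x - pos_part y.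
  by have := pos_part_linear (-1) y x; rewrite !scaleN1r ![- _ + _]addrC.
have nB x y : neg_part (x - y) = neg_part x - neg_part y.
  by have := neg_part_linear (-1) y x; rewrite !scaleN1r ![- _ + _]addrC.
have [|lp hlp] := pos_form_complete (u := pos_part \o u).
  move=> e e0; have [N hN] := hu e e0; exists N => m n Nm Nn.
  by rewrite /= -pB; apply: le_lt_trans (pos_part_norm_le _) (hN _ _ Nm Nn).
have [|lm hlm] := neg_form_complete (u := neg_part \o u).
  move=> e e0; have [N hN] := hu e e0; exists N => m n Nm Nn.
  by rewrite /= -nB; apply: le_lt_trans (neg_part_norm_le _) (hN _ _ Nm Nn).
exists (\val lp + \val lm) => e e0.
have e2 : 0 < e / 2 by rewrite divr_gt0.
have [N hN] := hlp _ e2; have [M hM] := hlm _ e2.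
exists (maxn N M) => n; rewrite geq_max => /andP[Nn Mn].
rewrite -(part_sum (u n)) opprD addrACA.
apply: le_lt_trans (ip_normD sip _ _) _.
rewrite -!subspace_valB (fund_norm_pos (_ - _)) (fund_norm_neg (_ - _)).
by have := hN _ Nn; have := hM _ Mn; rewrite /=; lra.
Qed.

End FundamentalDecomposition.

Section Swap.
Context {R : realType} {H : lmodType R[i]} (form : hermitian_form H).
Context (Hp Hm : submodClosed H).

(** Reversing the sign of the form exchanges the two summands; this transports
    every statement about positive subspaces to negative ones. *)
Lemma fundamental_decomposition_opp :
  fundamental_decomposition form Hp Hm ->
  fundamental_decomposition (opp_form form) Hm Hp.
Proof.
case=> dec disj orth hp hm; split.
- by move=> x; have [y [z ->]] := dec x; exists z, y; rewrite addrC.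
- by move=> x xm xp; exact: disj.
- move=> x y xm yp.
  by rewrite /= /opp_form (herm_conj (hermitian_form_fun form)) orth // conjc0 oppr0.
- exact: hm.
- have E : neg_form (opp_form form) Hp = pos_form form Hp :> (_ -> _ -> _).
    by apply/funext => x; apply/funext => y; rewrite /= /opp_form /sub_form opprK.
  by move: hp; rewrite /is_hilbert E.
Qed.

Lemma fund_ip_opp : fund_ip (opp_form form) Hm Hp = fund_ip form Hp Hm.
Proof.
apply/funext => x; apply/funext => y.
by rewrite /fund_ip /= /opp_form opprK addrC.
Qed.

End Swap.

(** The form is bounded for the second norm, so on its unit ball the functionals
    [fund_ip form Gp Gm x] are pointwise bounded, hence uniformly bounded. *)
Lemma fund_norm_equiv (R : realType) (H : lmodType R[i])
    (form : hermitian_form H) (Gp Gm Hp Hm : submodClosed H) :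
  fundamental_decomposition form Gp Gm -> fundamental_decomposition form Hp Hm ->
  exists2 C : R, 0 < C & forall x,
    ip_norm (fund_ip form Gp Gm) x <= C * ip_norm (fund_ip form Hp Hm) x.
Proof.
move=> fdG fdH.
apply: (uniform_boundedness (fund_ip_inner_product fdG) (fund_ip_complete fdG)
  (v := id) (N := ip_norm (fund_ip form Hp Hm))) => [x|y].
  exact: ip_norm_ge0.
exists (ip_norm (fund_ip form Hp Hm) (component Gp Gm y - component Gm Gp y)) => x.
rewrite (fund_ip_form fdG) mulrC; exact: form_bounded.
Qed.

(** * Maximal uniformly positive subspaces *)

Section Subspaces.
Context {R : realType} {H : lmodType R[i]}.

Lemma submod_closed_set (L : set H) : GRing.submod_closed (mem L) ->
  exists Ls : submodClosed H, forall x, x \in Ls <-> L x.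
Proof.
move=> cL; pose f (x : H) : bool := x \in L.
have cf : GRing.subsemimod_closed f.
  by apply: GRing.submod_closed_semi; exact: cL.
pose m := GRing.isSubmodClosed.Build R[i] H f cf.
pose Ls : submodClosed H := HB.pack f m.
by exists Ls => x; split=> [xL|Lx]; [apply: set_mem|apply: mem_set].
Qed.

Lemma submod_closedP (L : set H) : GRing.submod_closed (mem L) <->
  L 0 /\ forall a x y, L x -> L y -> L (a *: x + y).
Proof.
split=> [[L0 hL]|[L0 hL]].
  split=> [|a x y Lx Ly]; first exact: set_mem.
  by apply: set_mem; apply: hL; apply: mem_set.
split=> [|a x y xL yL]; first exact: mem_set.
by apply: mem_set; apply: hL; apply: set_mem.
Qed.

(** A subspace that is closed in a Hilbert space is complete for any equivalent
    inner product. *)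
Lemma closed_subspace_complete (ip : H -> H -> R[i]) (L : submodClosed H)
    (g : subspace L -> subspace L -> R[i]) (c : R) :
  semi_inner_product ip -> complete_ip ip -> 0 < c ->
  (forall x, ip_norm ip (\val x) <= c * ip_norm g x) ->
  (forall x, ip_norm g x <= ip_norm ip (\val x)) ->
  (forall l, (forall e : R, 0 < e -> exists2 x, x \in L & ip_norm ip (x - l) < e) ->
     l \in L) ->
  complete_ip g.
Proof.
move=> sip cip c0 h1 h2 closed u hu.
have [|l hl] := cip (fun n => \val (u n)).
  move=> e e0; have [|N hN] := hu (e / c); first by rewrite divr_gt0.
  exists N => m n Nm Nn; rewrite -subspace_valB; apply: le_lt_trans (h1 _) _.
  by rewrite mulrC -ltr_pdivlMr //; exact: hN.
have lL : l \in L.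
  apply: closed => e e0; have [N hN] := hl e e0.
  by exists (\val (u N)); [exact: (valP (u N))|exact: hN].
exists (to_subspace lL) => e e0; have [N hN] := hl e e0.
exists N => n Nn; apply: le_lt_trans (h2 _) _; rewrite subspace_valB; exact: hN.
Qed.

End Subspaces.

Section MaximalUniformlyPositive.
Context {R : realType} {H : lmodType R[i]} (form : hermitian_form H).
Context (Gp Gm : submodClosed H) (fdG : fundamental_decomposition form Gp Gm).
Local Notation ip := (fund_ip form Gp Gm).
Local Notation nrm := (ip_norm ip).
Let hf : hermitian_fun form := hermitian_form_fun form.
Let iip : inner_product ip := fund_ip_inner_product fdG.
Let sip : semi_inner_product ip := iip.1.

Lemma Re_form_le x : Re (form x x) <= nrm x ^+ 2.
Proof. by rewrite expr2; apply: le_trans (Re_le_normc _) (form_bounded fdG _ _). Qed.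

Lemma form_nondegenerate x : (forall y, form x y = 0) -> x = 0.
Proof. by move=> h; apply: iip.2; rewrite fund_ip_form // h. Qed.

(** Uniform positivity with a given constant is a closed condition: it says that
    the bounded Hermitian form [form - alpha ip] is nonnegative. *)
Lemma unif_pos_closure (alpha : R) (z : H) : 0 < alpha ->
  (forall e : R, 0 < e -> exists2 w,
     alpha * nrm w ^+ 2 <= Re (form w w) & nrm (w - z) < e) ->
  alpha * nrm z ^+ 2 <= Re (form z z).
Proof.
move=> a0 h; apply/ler_addgt0Pr => d d0.
pose c := 2 * (1 + alpha) * (nrm z + 1).
have z0 := ip_norm_ge0 ip z.
have c0 : 0 < c by rewrite !mulr_gt0 //; lra.
have [|w hw lt] := h (Num.min 1 (d / c)).
  by rewrite lt_min ltr01 divr_gt0.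
move: lt; rewrite lt_min => /andP[lt1]; rewrite ltr_pdivlMr // => lt2.
set v := w - z in lt1 lt2.
have wE : w = z + v by rewrite /v addrC subrK.
have v0 := ip_norm_ge0 ip v.
have fE : Re (form w w) = Re (form z z) + 2 * Re (form z v) + Re (form v v).
  by rewrite wE (Re_hermD hf).
have nE : nrm w ^+ 2 = nrm z ^+ 2 + 2 * Re (ip z v) + nrm v ^+ 2.
  by rewrite !(sqr_ip_norm sip) wE (Re_hermD sip.1).
have f1 : Re (form z v) <= nrm z * nrm v.
  exact: le_trans (Re_le_normc _) (form_bounded fdG _ _).
have f2 := Re_form_le v.
have n1 : - Re (ip z v) <= nrm z * nrm v.
  rewrite -ReN; apply: le_trans (Re_le_normc _) _; rewrite normcN.
  exact: cauchy_schwarz.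
rewrite fE nE in hw.
have n2 : alpha * (- Re (ip z v)) <= alpha * (nrm z * nrm v).
  by rewrite ler_wpM2l // ltW.
have n3 : 0 <= alpha * nrm v ^+ 2 by rewrite mulr_ge0 ?sqr_ge0 // ltW.
have n4 : nrm v ^+ 2 <= nrm v by rewrite expr2 -[leRHS]mulr1 ler_wpM2l // ltW.
have n5 : 0 <= alpha * nrm v by rewrite mulr_ge0 // ltW.
rewrite /c in lt2.
have -> : Re (form z z) + d = Re (form z z) + d by [].
move: hw f1 f2 n1 n2 n3 n4 n5 lt2.
move: (nrm v) (nrm z) v0 z0 => nv nz v0 z0.
move: (Re (form z v)) (Re (form v v)) (Re (ip z v)) => *.
nra.
Qed.

Context (L : set H) (maxL : maximal_uniformly_positive ip form L).

(** Maximality, used one vector at a time: if [L + span x] is still uniformly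
    positive, then it is [L]. *)
Lemma max_unif_pos_mem x (c : R) : 0 < c ->
  (forall a m, L m ->
     c * nrm (a *: x + m) ^+ 2 <= Re (form (a *: x + m) (a *: x + m))) -> L x.
Proof.
move=> c0 h; have [/submod_closedP[L0 LD] _ maxim] := maxL.
pose L' : set H := [set z | exists a m, L m /\ z = a *: x + m].
suff L'L : L' = L.
  by rewrite -L'L; exists 1, 0; rewrite scale1r addr0.
apply: maxim; last first.
- by move=> m Lm; exists 0, m; rewrite scale0r add0r.
- by exists c => // _ [a [m [Lm ->]]]; exact: h.
apply/submod_closedP; split; first by exists 0, 0; rewrite scale0r addr0.
move=> b _ _ [a1 [m1 [Lm1 ->]]] [a2 [m2 [Lm2 ->]]].
exists (b * a1 + a2), (b *: m1 + m2); split; first exact: LD.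
by rewrite scalerDr scalerA scalerDl addrACA.
Qed.

(** Maximality enters twice.  It forces [L] to be closed, since adjoining a limit
    point of [L] keeps uniform positivity; so [L] is a Hilbert space and the Riesz
    theorem yields the orthogonal projection onto it.  And a vector [x] orthogonal
    to [L] with [form x x > 0] could be adjoined to [L], so the form is nonpositive
    on the complement.  It is uniformly negative there because the projection is
    bounded: [|x|^2 = form x (j x) = form x (q (j x))], where [j] is the symmetry
    of the given decomposition and [q] projects onto the complement, and
    Cauchy-Schwarz for [- form] bounds this by a multiple of [|x|] times the norm
    of [x] for [- form]. *)
Lemma max_unif_pos_decomposition : exists Lp Lm : submodClosed H,
  [/\ forall x, x \in Lp <-> L x,
      forall x, x \in Lm <-> (forall y, L y -> form y x = 0) &
      fundamental_decomposition form Lp Lm].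
Proof.
have [cL [alpha a0 upL] maxim] := maxL.
have [Lp LpE] := submod_closed_set cL.
have [L0 LD] := (submod_closedP L).1 cL.
have [Lm LmE] : exists Lm : submodClosed H,
    forall x, x \in Lm <-> (forall y, L y -> form y x = 0).
  have [|Lm hLm] := @submod_closed_set R H [set x | forall y, L y -> form y x = 0].
    apply/submod_closedP; split=> [y _|a x x' hx hx' y Ly]; first exact: (herm0r hf).
    by rewrite (hermDr hf) (hermZr hf) hx // hx' // mulr0 addr0.
  by exists Lm.
exists Lp, Lm; split=> //.
pose gp := pos_form form Lp; pose gm := neg_form form Lm.
have orth x y : x \in Lp -> y \in Lm -> form x y = 0.
  by move=> /LpE Lx /LmE; apply.
have orth' x y : x \in Lm -> y \in Lp -> form x y = 0.
  by move=> xm yp; rewrite (herm_conj hf) orth // conjc0.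
pose s := Num.sqrt alpha.
have s0 : 0 < s by rewrite sqrtr_gt0.
have nrm_gp (x : subspace Lp) : nrm (\val x) <= s^-1 * ip_norm gp x.
  rewrite mulrC ler_pdivlMr //.
  have /upL h : L (\val x) by apply/LpE; exact: (valP x).
  rewrite -[X in X * _]ger0_norm ?ip_norm_ge0 // -sqrtr_sqr -sqrtrM ?sqr_ge0 //.
  by apply: ler_wsqrtr; rewrite mulrC.
have sgp : semi_inner_product gp.
  split=> [|x]; first exact: hermitian_form_fun.
  have /upL h : L (\val x) by apply/LpE; exact: (valP x).
  by apply: le_trans h; rewrite mulr_ge0 ?sqr_ge0 // ltW.
have igp : inner_product gp.
  split=> // x x0; apply: val_inj; apply: (ip_norm_eq0 iip).
  have := nrm_gp x; rewrite {2}/ip_norm x0 sqrtr0 mulr0 => le0.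
  by apply/eqP; rewrite eq_le le0 ip_norm_ge0.
have gp_nrm (x : subspace Lp) : ip_norm gp x <= nrm (\val x).
  by apply: ip_norm_le => //; exact: Re_form_le.
have cgp : complete_ip gp.
  apply: closed_subspace_complete sip (fund_ip_complete fdG) _ nrm_gp gp_nrm _.
    by rewrite invr_gt0.
  move=> l hl; apply/LpE; apply: (max_unif_pos_mem a0) => a m Lm'.
  apply: unif_pos_closure => // e e0.
  have a1 : 0 < normc a + 1 by have := normc_ge0 a; lra.
  have [|w /LpE Lw lt] := hl (e / (normc a + 1)); first by rewrite divr_gt0.
  exists (a *: w + m); first by apply: upL; exact: LD.
  have -> : a *: w + m - (a *: l + m) = a *: (w - l).
    by rewrite scalerBr opprD addrACA subrr addr0.
  rewrite ltr_pdivlMr // in lt; rewrite ip_normZ //; apply: le_lt_trans lt.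
  by rewrite mulrC ler_wpM2l ?ip_norm_ge0 // lerDl.
(* the component of x in Lp represents the functional form ^~ x *)
have dec x : exists y : subspace Lp, x - \val y \in Lm.
  have [|||y hy] := riesz igp cgp (phi := fun y => form (\val y) x)
    (M := s^-1 * nrm x).
  - move=> a y y'.
    have -> : \val (a *: y + y') = a *: \val y + \val y' :> H by rewrite linearP.
    exact: hf.1.
  - by rewrite mulr_ge0 ?ip_norm_ge0 // invr_ge0 ltW.
  - move=> y; apply: le_trans (form_bounded fdG _ _) _.
    by rewrite mulrAC ler_wpM2r ?ip_norm_ge0 //; exact: nrm_gp.
  exists y; apply/LmE => z /LpE zp.
  have := hy (to_subspace zp); rewrite /= (hermBr hf) => ->.
  exact: subrr.
(* |a *: x + m|^2 <= 2 |a *: x|^2 + 2 |m|^2, and the constant is a minimum so that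
   each square is dominated by the value of the form on the same vector *)
have neg x : x \in Lm -> Re (form x x) <= 0.
  move=> xm; rewrite leNgt; apply/negP => pos.
  have n1 : 0 < 2 * nrm x ^+ 2 + 1 by have := sqr_ge0 (nrm x); lra.
  suff Lx : L x by move: pos; rewrite orth ?ltxx //; apply/LpE.
  apply: (@max_unif_pos_mem x (Num.min (alpha / 2) (Re (form x x) / (2 * nrm x ^+ 2 + 1)))).
    by rewrite lt_min !divr_gt0.
  set c := Num.min _ _ => a m Lmm.
  have c1 : c <= alpha / 2 by rewrite ge_min lexx.
  have c2 : c * (2 * nrm x ^+ 2 + 1) <= Re (form x x).
    by rewrite -ler_pdivlMr // ge_min lexx orbT.
  have c0 : 0 <= c by rewrite le_min !divr_ge0 // ltW.
  have fE : Re (form (a *: x + m) (a *: x + m)) =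
      normc a ^+ 2 * Re (form x x) + Re (form m m).
    rewrite (Re_hermD hf) (Re_hermZ hf) (hermZl hf).
    by rewrite (orth' x m) // ?mulr0 ?addr0 //; apply/LpE.
  have nE : nrm (a *: x + m) ^+ 2 <= 2 * (normc a ^+ 2 * nrm x ^+ 2) + 2 * nrm m ^+ 2.
    have h1 : nrm (a *: x + m) <= normc a * nrm x + nrm m.
      by rewrite -(ip_normZ sip); exact: ip_normD.
    have h2 := ip_norm_ge0 ip (a *: x + m).
    have h3 : nrm (a *: x + m) ^+ 2 <= (normc a * nrm x + nrm m) ^+ 2.
      by rewrite ler_pXn2r ?nnegrE // (le_trans h2 h1).
    have := sqr_ge0 (normc a * nrm x - nrm m); move: h3.
    rewrite -exprMn; move: (normc a * nrm x) => t; nra.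
  apply: le_trans (ler_wpM2l c0 nE) _; rewrite fE mulrDr; apply: lerD.
    have -> : c * (2 * (normc a ^+ 2 * nrm x ^+ 2)) =
      normc a ^+ 2 * (c * (2 * nrm x ^+ 2)) by ring.
    by rewrite ler_wpM2l ?sqr_ge0 //; apply: le_trans c2; rewrite ler_wpM2l // lerDl.
  apply: le_trans (upL _ Lmm); rewrite mulrA ler_wpM2r ?sqr_ge0 //; lra.
have sgm : semi_inner_product gm.
  split=> [|x]; first exact: hermitian_form_fun.
  by rewrite /gm /= /opp_form ReN oppr_ge0; apply: neg; exact: (valP x).
have igm : inner_product gm.
  split=> // x x0; apply: val_inj; apply: form_nondegenerate => y.
  have [z hz] := dec y.
  rewrite -(subrK (\val z) y) (hermDr hf) [X in _ + X]orth' ?addr0; first last.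
  - exact: (valP z).
  - exact: (valP x).
  have := cauchy_schwarz sgm x (to_subspace hz); rewrite {1}/ip_norm x0 sqrtr0 mul0r.
  move=> le0; have /eq0_normc/eqP : normc (gm x (to_subspace hz)) = 0.
    by apply/eqP; rewrite eq_le le0 normc_ge0.
  by rewrite /gm /= /opp_form /sub_form /= oppr_eq0 => /eqP.
have gm_nrm (x : subspace Lm) : ip_norm gm x <= nrm (\val x).
  apply: ip_norm_le => //; rewrite expr2; apply: le_trans (Re_le_normc _) _.
  by rewrite /gm /= /opp_form normcN; exact: (form_bounded fdG (\val x) (\val x)).
(* jx is the image of x under the symmetry, w its component in Lm *)
have nrm_gm (x : subspace Lm) : nrm (\val x) <= (1 + alpha^-1) * ip_norm gm x.
  set jx := component Gp Gm (\val x) - component Gm Gp (\val x).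
  have njx : nrm jx = nrm (\val x) by exact: symmetry_norm.
  have [y hy] := dec jx.
  have ny : nrm (\val y) <= alpha^-1 * nrm (\val x).
    have yL : \val y \in Lp by exact: (valP y).
    have : alpha * nrm (\val y) ^+ 2 <= nrm (\val y) * nrm (\val x).
      apply: le_trans (upL _ ((LpE _).1 yL)) _.
      have -> : form (\val y) (\val y) = form (\val y) jx.
        by rewrite -(subrK (\val y) jx) (hermDr hf) [X in _ = X + _]orth ?add0r.
      rewrite -njx; exact: le_trans (Re_le_normc _) (form_bounded fdG _ _).
    have [-> _|y_neq0 h] := eqVneq (nrm (\val y)) 0.
      by rewrite mulr_ge0 ?ip_norm_ge0 ?invr_ge0 ?ltW.
    have y0 : 0 < nrm (\val y) by rewrite lt_def y_neq0 ip_norm_ge0.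
    by rewrite expr2 mulrCA ler_pM2l // in h; rewrite ler_pdivlMl.
  pose w : subspace Lm := to_subspace hy.
  have nw : ip_norm gm w <= (1 + alpha^-1) * nrm (\val x).
    apply: le_trans (gm_nrm _) _; rewrite /= mulrDl mul1r -{1}njx.
    apply: le_trans (ip_normD sip _ _) _; rewrite (ip_normN sip) lerD2l; exact: ny.
  have : nrm (\val x) ^+ 2 <= ip_norm gm x * ((1 + alpha^-1) * nrm (\val x)).
    rewrite (sqr_ip_norm sip) (fund_ip_form fdG) -/jx.
    have -> : form (\val x) jx = - gm x w.
      have -> : gm x w = - form (\val x) (jx - \val y) by [].
      by rewrite opprK (hermBr hf) (orth' _ _ (valP x) (valP y)) subr0.
    apply: le_trans (Re_le_normc _) _; rewrite normcN.
    apply: le_trans (cauchy_schwarz sgm _ _) _.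
    by rewrite ler_wpM2l ?ip_norm_ge0.
  have [-> _|x_neq0 h] := eqVneq (nrm (\val x)) 0.
    by rewrite mulr_ge0 ?ip_norm_ge0 // addr_ge0 // invr_ge0 ltW.
  have x0 : 0 < nrm (\val x) by rewrite lt_def x_neq0 ip_norm_ge0.
  by rewrite expr2 mulrA ler_pM2r // in h; rewrite mulrC.
have cgm : complete_ip gm.
  apply: closed_subspace_complete sip (fund_ip_complete fdG) _ nrm_gm gm_nrm _.
    by rewrite addr_gt0 ?invr_gt0.
  move=> l hl; apply/LmE => y Ly; apply: eq0_normc; apply/eqP.
  rewrite eq_le normc_ge0 andbT; apply/ler_addgt0Pr => e e0; rewrite add0r.
  have y1 : 0 < nrm y + 1 by have := ip_norm_ge0 ip y; lra.
  have [|w /LmE hw lt] := hl (e / (nrm y + 1)); first by rewrite divr_gt0.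
  have -> : form y l = - form y (w - l) by rewrite (hermBr hf) hw // sub0r opprK.
  rewrite normcN; apply: le_trans (form_bounded fdG _ _) _.
  rewrite ltr_pdivlMr // in lt; apply: le_trans (ltW lt).
  by rewrite mulrC ler_wpM2l ?ip_norm_ge0 // lerDl.
split.
- by move=> x; have [y hy] := dec x; exists y, (to_subspace hy); rewrite /= subrKC.
- move=> x xp xm; apply: congr1 (\val : subspace Lp -> H) _ _ (igp.2 (to_subspace xp) _).
  by rewrite /gp /= /sub_form /= orth.
- exact: orth.
- exact/hilbertP.
- exact/hilbertP.
Qed.

End MaximalUniformlyPositive.

(** * Operators and Bessel families in a Krein space *)

Lemma linear_of (R : realType) (V W : lmodType R[i]) (f : V -> W) : linear f ->
  exists F : {linear V -> W}, F =1 f.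
Proof.
move=> linf; pose m := GRing.isLinear.Build R[i] V W *:%R f linf.
pose F : {linear V -> W} := HB.pack f m.
by exists F.
Qed.

Lemma subspace_valP (R : realType) (H : lmodType R[i]) (L : submodClosed H) a
    (x y : subspace L) : \val (a *: x + y) = a *: \val x + \val y.
Proof. exact: linearP. Qed.

Section Operators.
Context {R : realType} {V W : lmodType R[i]}.
Context (g : V -> V -> R[i]) (h : W -> W -> R[i]).
Context (ig : inner_product g) (cg : complete_ip g) (ih : inner_product h).
Let sg : semi_inner_product g := ig.1.
Let hg : hermitian_fun g := sg.1.

Lemma is_adjoint_sym (T : V -> W) (T' : W -> V) :
  is_adjoint g h T T' -> is_adjoint h g T' T.
Proof.
move=> adj y x; rewrite (herm_conj hg) -adj (herm_conj ih.1.1); exact: conjcK.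
Qed.

Lemma adjoint_bound (T : V -> W) (T' : W -> V) (k : R) :
  is_adjoint g h T T' -> 0 <= k ->
  (forall y, ip_norm g (T' y) <= k * ip_norm h y) ->
  forall x, ip_norm h (T x) <= k * ip_norm g x.
Proof.
move=> adj k0 hk x; have [->|T_neq0] := eqVneq (ip_norm h (T x)) 0.
  by rewrite mulr_ge0 ?ip_norm_ge0.
have Tpos : 0 < ip_norm h (T x) by rewrite lt_def T_neq0 ip_norm_ge0.
rewrite -(ler_pM2l Tpos) -expr2 (sqr_ip_norm ih.1) adj.
apply: le_trans (Re_le_normc _) _; apply: le_trans (cauchy_schwarz sg _ _) _.
rewrite mulrC mulrA [_ * k]mulrC ler_wpM2r ?ip_norm_ge0 //; exact: hk.
Qed.

Lemma contraction_bound (T : {linear V -> W}) : uniform_contraction g h T ->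
  exists k : R, [/\ 0 <= k, k < 1 & forall x, ip_norm h (T x) <= k * ip_norm g x].
Proof.
move=> [[M hM] lt1]; exists (op_norm g h T).
set E := [set ip_norm h (T x) | x in [set x | ip_norm g x <= 1]].
have ubE : has_ubound E.
  exists `|M| => _ [x /= x1 <-]; apply: le_trans (hM x) _.
  apply: (@le_trans _ _ (`|M| * ip_norm g x)).
    by rewrite ler_wpM2r ?ip_norm_ge0 // ler_norm.
  by rewrite -[leRHS]mulr1 ler_wpM2l.
have E0 : E 0.
  by exists 0; rewrite /= ?(ip_norm0 sg) ?ler01 // linear0 (ip_norm0 ih.1).
have k0 : 0 <= op_norm g h T by exact: (ub_le_sup ubE).
split=> // x; have [x0|x_neq0] := eqVneq (ip_norm g x) 0.
  by rewrite (ip_norm_eq0 ig x0) linear0 (ip_norm0 ih.1) (ip_norm0 sg) mulr0.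
have xpos : 0 < ip_norm g x by rewrite lt_def x_neq0 ip_norm_ge0.
have scale : normc (((ip_norm g x)^-1)%:C%C : R[i]) = (ip_norm g x)^-1.
  by rewrite normc_real ger0_norm // invr_ge0 ltW.
rewrite -ler_pdivrMr // mulrC -scale -(ip_normZ ih.1) -linearZ.
apply: (ub_le_sup ubE); exists (((ip_norm g x)^-1)%:C%C *: x) => //=.
by rewrite (ip_normZ sg) scale mulVf.
Qed.

Lemma bound_contraction (T : V -> W) (k : R) : T 0 = 0 -> k < 1 -> 0 <= k ->
  (forall x, ip_norm h (T x) <= k * ip_norm g x) -> uniform_contraction g h T.
Proof.
move=> T0 k1 k0 hk; split; first by exists k.
apply: le_lt_trans k1; apply: ge_sup.
  by exists (ip_norm h (T 0)), 0 => //=; rewrite (ip_norm0 sg).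
move=> _ [x /= x1 <-]; apply: le_trans (hk x) _.
by rewrite -[leRHS]mulr1 ler_wpM2l.
Qed.

(** Symmetry alone bounds the operator; the lower bound gives injectivity and
    bounds the inverse. *)
Lemma coercive_uniformly_positive (T : V -> V) (c : R) : linear T ->
  is_adjoint g g T T -> 0 < c ->
  (forall x, c * ip_norm g x ^+ 2 <= Re (g (T x) x)) ->
  uniformly_positive_op g T.
Proof.
move=> linT symT c0 coer; have [M _ hM] := symmetric_bounded ig cg symT.
have [F FE] := linear_of linT.
have lower x : c * ip_norm g x <= ip_norm g (T x).
  have [->|x_neq0] := eqVneq (ip_norm g x) 0; first by rewrite mulr0 ip_norm_ge0.
  have xpos : 0 < ip_norm g x by rewrite lt_def x_neq0 ip_norm_ge0.
  rewrite -(ler_pM2r xpos) -mulrA -expr2; apply: le_trans (coer x) _.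
  exact: le_trans (Re_le_normc _) (cauchy_schwarz sg _ _).
have [|Ti TiK] := @choice _ _ (fun y x => T x = y).
  move=> y; have [|||x hx] := @coercive_surjective _ _ _ ig cg F c _ _ _ y => //.
  - by move=> x z; rewrite !FE.
  - by move=> x; rewrite FE.
  - by exists x; rewrite -FE.
have injT : injective T.
  move=> x y Txy; apply/eqP; rewrite -subr_eq0; apply/eqP; apply: (ip_norm_eq0 ig).
  have := lower (x - y); rewrite -FE linearB !FE Txy subrr (ip_norm0 sg).
  by rewrite pmulr_rle0 // => le0; apply/eqP; rewrite eq_le le0 ip_norm_ge0.
have linTi : linear Ti.
  by move=> a x y; apply: injT; rewrite linT !TiK.
have [G GE] := linear_of linTi.
split.
- by split=> //; exists M.
- move=> x x_neq0; rewrite ltcE /=.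
  have -> : Im (g (T x) x) = 0.
    have := symT x x; rewrite [X in _ = X](herm_conj hg).
    by case: (g (T x) x) => a b [] /= h0; lra.
  rewrite eqxx /=; apply: lt_le_trans (coer x).
  rewrite mulr_gt0 // exprn_gt0 // lt_def ip_norm_ge0 andbT.
  by apply: contra_neq x_neq0; exact: ip_norm_eq0.
- exists G; split.
  + exists c^-1 => y; rewrite GE ler_pdivlMl //.
    by apply: le_trans (lower _) _; rewrite TiK.
  + by move=> x; rewrite GE; apply: injT; rewrite TiK.
  + by move=> y; rewrite GE TiK.
Qed.

End Operators.

Lemma fundamental_decomposition_oppV (R : realType) (H : lmodType R[i])
    (form : hermitian_form H) (Hp Hm : submodClosed H) :
  fundamental_decomposition (opp_form form) Hm Hp ->
  fundamental_decomposition form Hp Hm.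
Proof.
case=> dec disj orth hm hp; split.
- by move=> x; have [y [z ->]] := dec x; exists z, y; rewrite addrC.
- by move=> x xm xp; exact: disj.
- move=> x y xp ym; rewrite (herm_conj (hermitian_form_fun form)).
  by have /eqP := orth y x ym xp; rewrite /= /opp_form oppr_eq0 => /eqP ->; rewrite conjc0.
- have E : neg_form (opp_form form) Hp = pos_form form Hp :> (_ -> _ -> _).
    by apply/funext => x; apply/funext => y; rewrite /= /opp_form /sub_form opprK.
  by move: hp; rewrite /is_hilbert E.
- exact: hm.
Qed.

Section BesselSynthesis.
Context {R : realType} {H : lmodType R[i]} (form : hermitian_form H).
Context (Gp Gm : submodClosed H) (fdG : fundamental_decomposition form Gp Gm).
Local Notation ip := (fund_ip form Gp Gm).
Local Notation nrm := (ip_norm ip).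
Let hf : hermitian_fun form := hermitian_form_fun form.
Let iip : inner_product ip := fund_ip_inner_product fdG.
Let sip : semi_inner_product ip := iip.1.
Let cip : complete_ip ip := fund_ip_complete fdG.

Context (I : choiceType) (f : I -> H).

Lemma bessel_boundP : bessel ip f -> exists2 b : R, 0 <= b & bessel_bound ip f b.
Proof.
case=> beta hb; exists (Num.sqrt `|beta|) => [|x A]; first exact: sqrtr_ge0.
have /(esum_leP _ (fun i => sqr_ge0 (normc (ip x (f i))))) h := hb x.
apply: le_trans (h A) _; rewrite exprMn (sqr_sqrtr (normr_ge0 beta)).
by rewrite ler_wpM2r ?sqr_ge0 // ler_norm.
Qed.

Context (b : R) (b0 : 0 <= b) (hb : bessel_bound ip f b).

Lemma form_fund_ip x y : form x y = ip (component Gp Gm x - component Gm Gp x) y.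
Proof.
have e : form y x = ip y (component Gp Gm x - component Gm Gp x).
  rewrite fund_ip_form //; congr (form y _).
  have [-> ->] : component Gp Gm (component Gp Gm x - component Gm Gp x) =
      component Gp Gm x /\
    component Gm Gp (component Gp Gm x - component Gm Gp x) = - component Gm Gp x.
    by apply: (component_unique fdG);
      rewrite ?submodN ?(component_pos fdG) ?(component_neg fdG).
  by rewrite opprK (component_sum fdG).
by rewrite (herm_conj hf) e -(herm_conj sip.1).
Qed.

Lemma form_sq_summable x : sq_summable (fun i => form x (f i)).
Proof.
have [c hc] := bessel_sq_summable (component Gp Gm x - component Gm Gp x) hb.
by exists c => A; under eq_bigr do rewrite form_fund_ip; exact: hc.
Qed.

Context (P : pred I).
Local Notation fP := (restrict_fam P f).
Local Notation frame_op x := (synthesis ip P f (fun i => form x (f i))).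

Lemma synthesis_sums_to a : sq_summable a ->
  sums_to ip (fun i => a i *: fP i) (synthesis ip P f a).
Proof.
move=> ha; have [v hv] := bessel_sums_to iip cip b0 (bessel_restrict iip P hb) ha.
suff -> : synthesis ip P f a = v by [].
apply: (usumE iip); apply: eq_sums_to hv => i.
by rewrite /restrict_fam; case: ifP => // _; rewrite scaler0.
Qed.

Lemma frame_op_range x : (synthesis ip P f @` @ell2 R I) (frame_op x).
Proof. by exists (fun i => form x (f i)) => //; apply/ell2P; exact: form_sq_summable. Qed.

(** [form (frame_op x) x] is the full sum of the [|form x (f i)|^2], of which the
    left-hand side is a partial sum. *)
Lemma frame_op_coef_le x (A : {fset I}) :
  \sum_(i <- A) normc (form x (fP i)) ^+ 2 <= Re (form (frame_op x) x).
Proof.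
apply/ler_addgt0Pr => e e0.
have hs := synthesis_sums_to (form_sq_summable x).
have [B hB] := sums_to_ip sip (component Gp Gm x - component Gm Gp x) hs e0.
have := hB _ (fsubsetUl B A).
rewrite -(form_fund_ip x) (Re_hermC hf x).
under eq_bigr do rewrite -form_fund_ip.
have -> : \sum_(i <- (B `|` A)%fset) form x (form x (f i) *: fP i) =
    (\sum_(i <- (B `|` A)%fset) normc (form x (fP i)) ^+ 2)%:C%C.
  rewrite (big_morph (real_complex R) (@rmorphD _ _ _) (rmorph0 _)).
  apply: eq_bigr => i _; rewrite (hermZr hf) -mulc_conj mulrC /restrict_fam.
  by case: ifP => // _; rewrite (herm0r hf) mul0r mul0r.
set t := \sum_(i <- (B `|` A)%fset) _ => /ltW le_e.
have : \sum_(i <- A) normc (form x (fP i)) ^+ 2 <= t.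
  rewrite /t (sum_fset_subset _ (fsubsetUr B A)) lerDl.
  by apply: sumr_ge0 => i _; exact: sqr_ge0.
have := le_trans (Re_le_normc _) le_e; rewrite ReB /=; lra.
Qed.

Lemma form_synthesis_le x a (ca cx : R) : 0 <= ca -> 0 <= cx ->
  (forall A : {fset I}, \sum_(i <- A) normc (a i) ^+ 2 <= ca ^+ 2) ->
  (forall A : {fset I}, \sum_(i <- A) normc (form x (fP i)) ^+ 2 <= cx ^+ 2) ->
  normc (form x (synthesis ip P f a)) <= ca * cx.
Proof.
move=> ca0 cx0 ha hx.
have hs : sums_to ip (fun i => a i *: fP i) (synthesis ip P f a).
  by apply: synthesis_sums_to; exists (ca ^+ 2).
rewrite form_fund_ip -[X in normc X]subr0.
apply: (sums_to_ip_le sip (A0 := fset0) hs) => B _.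
rewrite subr0; under eq_bigr do rewrite -form_fund_ip (hermZr hf).
apply: normc_sumM_le => //.
by under eq_bigr do rewrite normc_conj.
Qed.

(** [frame_op x] lies in the range, so [form (frame_op x) x = 0]; as this is the
    sum of the squared coefficients, they all vanish. *)
Lemma frame_op_eq0 x :
  (forall y, (synthesis ip P f @` @ell2 R I) y -> form y x = 0) -> frame_op x = 0.
Proof.
move=> xL.
have coef0 i : form x (fP i) = 0.
  have := frame_op_coef_le x [fset i]%fset.
  rewrite big_seq_fset1 (xL _ (frame_op_range x)) /= => le0.
  apply: eq0_normc; apply/eqP; rewrite -sqrf_eq0 eq_le le0 sqr_ge0.
  by [].
apply: (usumE iip) => e e0; exists fset0 => B _.
rewrite big1 ?subrr ?ip_norm0 // => i _.
have := coef0 i; rewrite /restrict_fam; case: ifP => // _ ->.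
by rewrite scale0r.
Qed.

(** A Bessel family whose synthesis operator maps onto the positive summand of a
    fundamental decomposition has a lower frame bound there: the number
    [form (frame_op x) x] controls every functional [form x y], [y] being a
    synthesized vector, so uniform boundedness applies.  The decomposition may
    refer to [form] or to its opposite, since only [|form x y|] matters. *)
Lemma lower_frame_bound (form' : hermitian_form H) (Lp Lm : submodClosed H) :
  (forall x y, normc (form' x y) = normc (form x y)) ->
  (forall x, x \in Lp <-> (synthesis ip P f @` @ell2 R I) x) ->
  forall fd : fundamental_decomposition form' Lp Lm,
  exists2 c : R, 0 < c & forall x,
    c * ip_norm (pos_form form' Lp) (pos_part fd x) ^+ 2 <=
    Re (form (frame_op x) x).
Proof.
move=> eq_norm LpE fd; pose r x := Re (form (frame_op x) x).
have r0 x : 0 <= r x.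
  by have := frame_op_coef_le x (fset0 : {fset I}); rewrite big_seq_fset0.
have [||C C0 hC] := uniform_boundedness (pos_form_ip fd) (pos_form_complete fd)
  (v := pos_part fd) (N := fun x => Num.sqrt (r x)).
- by move=> x; exact: sqrtr_ge0.
- move=> y; have /LpE[a /ell2P/sq_summable_sqr[ca ca0 ha] ya] := valP y.
  exists ca => x.
  have -> : pos_form form' Lp (pos_part fd x) y = form' x (\val y).
    rewrite -[in RHS](component_sum fd x) (hermDl (hermitian_form_fun form')).
    by rewrite (form_neg_pos fd (component_neg fd x) (valP y)) addr0.
  rewrite eq_norm -ya; apply: form_synthesis_le => //.
  by move=> A; rewrite sqr_sqrtr //; exact: frame_op_coef_le.
exists (C ^- 2) => [|x]; first by rewrite invr_gt0 exprn_gt0.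
rewrite -/(r x) ler_pdivrMl ?exprn_gt0 // -[r x](sqr_sqrtr (r0 x)) -exprMn.
rewrite ler_pXn2r ?nnegrE ?ip_norm_ge0 ?mulr_ge0 ?sqrtr_ge0 //; last exact: ltW.
Qed.

End BesselSynthesis.

(** * From a J-frame to the block representation *)

Section BlockRepresentation.
Context {R : realType} {H : lmodType R[i]} (form : hermitian_form H).
Context (Gp Gm : submodClosed H) (fdG : fundamental_decomposition form Gp Gm).
Local Notation ip := (fund_ip form Gp Gm).
Local Notation nrm := (ip_norm ip).
Let hf : hermitian_fun form := hermitian_form_fun form.
Let iip : inner_product ip := fund_ip_inner_product fdG.

Definition block_representation (Hp Hm : submodClosed H) (S : H -> H) : Prop :=
  exists (A : {linear subspace Hp -> subspace Hp})
         (K : {linear subspace Hm -> subspace Hp})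
         (K' : {linear subspace Hp -> subspace Hm})
         (D : {linear subspace Hm -> subspace Hm}),
    [/\ block_operator S A (fun y => - A (K y)) (fun x => K' (A x)) D,
        uniformly_positive_op (pos_form form Hp) A,
        uniform_contraction (neg_form form Hm) (pos_form form Hp) K,
        is_adjoint (neg_form form Hm) (pos_form form Hp) K K'
      & bounded_selfadjoint (neg_form form Hm) D /\
        uniformly_positive_op (neg_form form Hm) (fun y => D y + K' (A (K y)))].

(** The vectors [S x] with [x] in [Hp] lie in [L], because [Sm] vanishes there, and
    their positive parts [A x] exhaust [Hp].  Hence [L] is the graph of the map
    [K'] sending [A x] to the negative part of [S x], and uniform positivity of
    [L] makes it a contraction.  Applied to the points [Sp y] of this graph, this
    gives [D + K' A K = - Sm] on [Hm]. *)
Lemma block_representation_of_splitting (Hp Hm : submodClosed H)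
    (S : {linear H -> H}) (Sp Sm : H -> H) (L : H -> Prop) (alpha c c' : R) :
  fundamental_decomposition form Hp Hm -> is_adjoint form form S S ->
  (forall x, S x = Sp x - Sm x) ->
  (forall x, Sm x \in Hm) -> (forall x, x \in Hp -> Sm x = 0) ->
  (forall x, L (Sp x)) -> (forall x y, L x -> L y -> L (x - y)) ->
  0 < alpha -> (forall z, L z -> alpha * nrm z ^+ 2 <= Re (form z z)) ->
  0 < c -> (forall x, x \in Hp -> c * Re (form x x) <= Re (form (Sp x) x)) ->
  0 < c' -> (forall y, y \in Hm -> c' * - Re (form y y) <= Re (form (Sm y) y)) ->
  block_representation Hp Hm S.
Proof.
move=> fd symS SE SmHm Sm0 LSp LB a0 upL c0 coerp c'0 coerm.
pose gp := pos_form form Hp; pose gm := neg_form form Hm.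
have igp : inner_product gp := pos_form_ip fd.
have igm : inner_product gm := neg_form_ip fd.
have cgp : complete_ip gp := pos_form_complete fd.
have cgm : complete_ip gm := neg_form_complete fd.
pose pp := pos_part fd; pose np := neg_part fd.
have ppD : linear pp := pos_part_linear fd.
have npD : linear np := neg_part_linear fd.
have ppB x y : pp (x - y) = pp x - pp y.
  by have := ppD (-1) y x; rewrite !scaleN1r ![- _ + _]addrC.
have npB x y : np (x - y) = np x - np y.
  by have := npD (-1) y x; rewrite !scaleN1r ![- _ + _]addrC.
have gpE x (y : subspace Hp) : gp (pp x) y = form x (\val y).
  rewrite -[in RHS](component_sum fd x) (hermDl hf).
  by rewrite (form_neg_pos fd (component_neg fd x) (valP y)) addr0.
have gmE x (y : subspace Hm) : gm (np x) y = - form x (\val y).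
  rewrite -[in RHS](component_sum fd x) (hermDl hf).
  by rewrite (form_pos_neg fd (component_pos fd x) (valP y)) add0r.
have gpEr (x : subspace Hp) y : gp x (pp y) = form (\val x) y.
  by rewrite (herm_conj igp.1.1) gpE -(herm_conj hf).
have gmEr (x : subspace Hm) y : gm x (np y) = - form (\val x) y.
  by rewrite (herm_conj igm.1.1) gmE conjcN -(herm_conj hf).
have [A AE] := @linear_of _ _ _ (fun x : subspace Hp => pp (S (\val x)))
  (fun a x y => etrans (congr1 (fun z => pp (S z)) (subspace_valP a x y))
    (etrans (congr1 pp (linearP S a (\val x) (\val y))) (ppD a _ _))).
have [D DE] := @linear_of _ _ _ (fun x : subspace Hm => np (S (\val x)))
  (fun a x y => etrans (congr1 (fun z => np (S z)) (subspace_valP a x y))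
    (etrans (congr1 np (linearP S a (\val x) (\val y))) (npD a _ _))).
have symA : is_adjoint gp gp A A.
  by move=> x y; rewrite !AE gpE gpEr; exact: symS.
have symD : is_adjoint gm gm D D.
  by move=> x y; rewrite !DE gmE gmEr; congr (- _); exact: symS.
have SHp (x : subspace Hp) : S (\val x) = Sp (\val x).
  by rewrite SE (Sm0 _ (valP x)) subr0.
have posA : uniformly_positive_op gp A.
  apply: (coercive_uniformly_positive igp cgp (c := c)) => // [|x].
    exact: linearP.
  rewrite (sqr_ip_norm igp.1) AE gpE SHp; exact: coerp (valP x).
have [_ _ [Ai [_ AK AiK]]] := posA.
have [K KE] := @linear_of _ _ _ (fun y : subspace Hm => - Ai (pp (S (\val y))))
  (fun a x y => etrans (congr1 (fun z => - Ai (pp (S z))) (subspace_valP a x y))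
    (etrans (congr1 (fun z => - Ai (pp z)) (linearP S a (\val x) (\val y)))
    (etrans (congr1 (fun z => - Ai z) (ppD a _ _))
    (etrans (congr1 -%R (linearP Ai a _ _))
    (etrans (opprD _ _) (congr1 (fun z => z - _) (esym (scalerN _ _)))))))).
have [K' K'E] := @linear_of _ _ _ (fun x : subspace Hp => np (S (\val (Ai x))))
  (fun a x y => etrans (congr1 (fun z => np (S (\val z))) (linearP Ai a x y))
    (etrans (congr1 (fun z => np (S z)) (subspace_valP a _ _))
    (etrans (congr1 np (linearP S a _ _)) (npD a _ _)))).
have ASi x : pp (S (\val (Ai x))) = x by rewrite -AE AiK.
have adjK : is_adjoint gm gp K K'.
  move=> y x; rewrite -{1}(AiK x) -symA KE raddfN /= AiK (hermNl igp.1.1) gpE.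
  by rewrite K'E gmEr symS.
(* two points of L with the same positive part differ by a vector on which the
   form is both nonnegative and nonpositive *)
have graph z : L z -> np z = K' (pp z).
  move=> Lz; set x := \val (Ai (pp z)); set w := z - S x.
  have Lw : L w by apply: LB => //; rewrite /x SHp.
  have ppw : pp w = 0 by rewrite ppB ASi subrr.
  have wE : w = \val (np w) by rewrite -{1}(part_sum fd w) -/pp ppw add0r.
  have w0 : nrm w = 0.
    have le0 : Re (form w w) <= 0.
      have gww : gm (np w) (np w) = - form w w.
        by rewrite gmE; congr (- form _ _); exact: esym wE.
      by have := igm.1.2 (np w); rewrite gww ReN oppr_ge0.
    have := le_trans (upL _ Lw) le0; rewrite pmulr_rle0 // => h.
    by apply/eqP; rewrite -sqrf_eq0 eq_le h sqr_ge0.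
  have := npB z (S x); rewrite -/w (ip_norm_eq0 iip w0) => e.
  have np0 : np 0 = 0 by have := npB 0 0; rewrite !subrr.
  by rewrite K'E; apply/eqP; rewrite -subr_eq0 -e np0.
have [C C0 hC] := fund_norm_equiv fd fdG.
(* |x|^2 - |K' x|^2 = form z z >= alpha |z|^2 >= d |x|^2 for the point z of L
   over x; the minimum with 1/2 keeps 1 - d nonnegative *)
pose d := Num.min (2^-1) (alpha / C ^+ 2).
have d0 : 0 < d by rewrite lt_min invr_gt0 ltr0n /= divr_gt0 ?exprn_gt0.
have d1 : 0 <= 1 - d.
  have : d <= 2^-1 by rewrite ge_min lexx.
  lra.
pose k := Num.sqrt (1 - d).
have k0 : 0 <= k by exact: sqrtr_ge0.
have k1 : k < 1.
  by rewrite -(@ltr_pXn2r _ 2) ?nnegrE // sqr_sqrtr // expr1n; lra.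
have K'bound (x : subspace Hp) : ip_norm gm (K' x) <= k * ip_norm gp x.
  rewrite -(@ler_pXn2r _ 2) ?nnegrE ?mulr_ge0 ?ip_norm_ge0 // exprMn.
  rewrite (sqr_sqrtr d1); set z := S (\val (Ai x)).
  have Lz : L z by rewrite /z SHp.
  have ppz : pp z = x by exact: ASi.
  have npz : np z = K' x by rewrite K'E.
  have zE : Re (form z z) = ip_norm gp x ^+ 2 - ip_norm gm (K' x) ^+ 2.
    rewrite -npz -ppz (sqr_ip_norm igp.1) (sqr_ip_norm igm.1) gpE gmE.
    rewrite ReN opprK -ReD -(hermDr hf) part_sum //.
  have xle : ip_norm gp x ^+ 2 <= C ^+ 2 * nrm z ^+ 2.
    rewrite -exprMn ler_pXn2r ?nnegrE ?mulr_ge0 ?ip_norm_ge0 ?(ltW C0) //.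
    by rewrite -ppz; apply: le_trans (pos_part_norm_le fd z) (hC z).
  have := upL _ Lz; rewrite zE.
  have : d * ip_norm gp x ^+ 2 <= alpha * nrm z ^+ 2.
    apply: (@le_trans _ _ (alpha / C ^+ 2 * ip_norm gp x ^+ 2)).
      by rewrite ler_wpM2r ?sqr_ge0 // ge_min lexx orbT.
    rewrite -mulrA ler_pM2l // ler_pdivrMl ?exprn_gt0 //.
  lra.
have Kbound : forall y : subspace Hm, ip_norm gp (K y) <= k * ip_norm gm y.
  by move=> y; apply: (adjoint_bound igm igp adjK k0) => x; exact: K'bound.
exists A, K, K', D; split=> //.
- move=> x y; rewrite linearD -(part_sum fd (S (\val x) + S (\val y))).
  have ppE : pp (S (\val x) + S (\val y)) = A x - A (K y).
    have := ppD 1 (S (\val x)) (S (\val y)); rewrite !scale1r => ->.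
    by rewrite AE KE raddfN opprK /= AiK.
  have npE : np (S (\val x) + S (\val y)) = K' (A x) + D y.
    have := npD 1 (S (\val x)) (S (\val y)); rewrite !scale1r => ->.
    by rewrite DE K'E AK.
  by rewrite -ppE -npE.
- by apply: (bound_contraction igm _ k1 k0 Kbound); exact: linear0.
split.
  split=> //; have [M _ hM] := symmetric_bounded igm cgm symD.
  by exists M.
have CE y : D y + K' (A (K y)) = - np (Sm (\val y)).
  rewrite DE KE raddfN /= AiK raddfN /=.
  have ppSm : pp (Sm (\val y)) = 0.
    by apply: val_inj; exact: (component_in_neg fd (SmHm _)).1.
  have -> : K' (pp (S (\val y))) = np (Sp (\val y)).
    by rewrite SE ppB ppSm subr0 graph.
  by rewrite SE npB addrAC subrr sub0r.
apply: (coercive_uniformly_positive igm cgm (c := c')) => // [a x y|x y|y].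
- by rewrite !linearP /= scalerDr addrACA.
- rewrite (hermDl igm.1.1) (hermDr igm.1.1) symD; congr (_ + _).
  rewrite (is_adjoint_sym igm igp adjK) symA.
  by rewrite -adjK.
- rewrite CE (hermNl igm.1.1) gmE opprK (sqr_ip_norm igm.1).
  by have := coerm _ (valP y); rewrite -ReN.
Qed.

End BlockRepresentation.

Lemma J_frame_operator_block (R : realType) (H : lmodType R[i])
    (form : hermitian_form H) (Gp Gm : submodClosed H) (S : {linear H -> H}) :
  fundamental_decomposition form Gp Gm -> is_adjoint form form S S ->
  is_J_frame_operator form (fund_ip form Gp Gm) S ->
  exists Hp Hm : submodClosed H,
    fundamental_decomposition form Hp Hm /\ block_representation form Hp Hm S.
Proof.
move=> fdG symS [I [f [[besf maxp maxm] SE]]].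
have hf := hermitian_form_fun form.
have [b b0 hb] := bessel_boundP besf.
have [Lp [Lm [LpE _ fdL]]] := max_unif_pos_decomposition fdG maxp.
have fdG' := fundamental_decomposition_opp fdG.
have [|Hm [Hp [HmE HpE fdH']]] := @max_unif_pos_decomposition _ _ _ _ _ fdG'
    (synthesis (fund_ip form Gp Gm) (neg_idx form f) f @` @ell2 R I).
  by rewrite fund_ip_opp.
have fdH := fundamental_decomposition_oppV fdH'.
exists Hp, Hm; split=> //.
have [_ [alpha a0 upL] _] := maxp.
have [c c0 hc] := lower_frame_bound fdG b0 hb (fun x y => erefl) LpE fdL.
have [c' c'0 hc'] := lower_frame_bound fdG b0 hb
  (form' := opp_form form) (fun x y => normcN (form x y)) HmE fdH'.
apply: (block_representation_of_splitting fdG (alpha := alpha) (c := c) (c' := c')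
  fdH symS (Sp := fun x => synthesis (fund_ip form Gp Gm) (pos_idx form f) f
     (fun i => form x (f i)))
  (Sm := fun x => synthesis (fund_ip form Gp Gm) (neg_idx form f) f
     (fun i => form x (f i)))
  (L := synthesis (fund_ip form Gp Gm) (pos_idx form f) f @` @ell2 R I)) => //.
- by move=> x; apply/HmE; exact: (frame_op_range fdG hb (neg_idx form f) x).
- move=> x /HpE xL; apply: (frame_op_eq0 fdG b0 hb) => y /xL /eqP.
  by rewrite /= /opp_form oppr_eq0 => /eqP.
- by move=> x; exact: (frame_op_range fdG hb (pos_idx form f) x).
- by move=> x y /LpE xL /LpE yL; apply/LpE; exact: submodB.
(* the component of x in Lm contributes negatively to form x x *)
- move=> x _; apply: le_trans (hc x); rewrite ler_pM2l //.
  rewrite (sqr_ip_norm (pos_form_ip fdL).1) -{1 2}(component_sum fdL x).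
  rewrite (Re_hermD hf) (form_pos_neg fdL (component_pos fdL x) (component_neg fdL x)).
  have := (neg_form_ip fdL).1.2 (neg_part fdL x).
  by rewrite /= /opp_form /sub_form /= ReN; lra.
- move=> y yHm; apply: le_trans (hc' y); rewrite ler_pM2l //.
  have yE : pos_part fdH' y = to_subspace yHm by exact: (pos_part_val fdH' (to_subspace yHm)).
  by rewrite yE (sqr_ip_norm (pos_form_ip fdH').1) -ReN.
Qed.

(** * From the block representation to a J-frame *)

(** For a uniformly positive operator [T], the form [g (T^-1 x) y] is an inner
    product equivalent to [g].  In an orthonormal basis [e] of it,
    [T x = \sum_i g x (e i) *: e i], so [e] is a frame with frame operator [T]. *)
Lemma inverse_inner_product (R : realType) (V : lmodType R[i])
    (g : V -> V -> R[i]) (T : V -> V) : inner_product g -> complete_ip g ->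
  uniformly_positive_op g T ->
  exists g1 : V -> V -> R[i], [/\ inner_product g1, complete_ip g1,
    forall x y, g1 (T x) y = g x y,
    exists2 c : R, 0 < c & forall x, ip_norm g x <= c * ip_norm g1 x
  & exists2 c : R, 0 < c & forall x, ip_norm g1 x <= c * ip_norm g x].
Proof.
move=> ig cg [[[M hM] symT] posT [Ti [[N hN] TK TiK]]].
have sg := ig.1; have hg := sg.1.
pose g1 x y := g (Ti x) y.
have hM' x : ip_norm g (T x) <= (`|M| + 1) * ip_norm g x.
  apply: le_trans (hM x) _; rewrite ler_wpM2r ?ip_norm_ge0 //.
  by have := ler_norm M; lra.
have hN' x : ip_norm g (Ti x) <= (`|N| + 1) * ip_norm g x.
  apply: le_trans (hN x) _; rewrite ler_wpM2r ?ip_norm_ge0 //.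
  by have := ler_norm N; lra.
have M0 : 0 < `|M| + 1 by have := normr_ge0 M; lra.
have N0 : 0 < `|N| + 1 by have := normr_ge0 N; lra.
have T0 : T 0 = 0 by rewrite -[in LHS](linear0 Ti) TiK.
have g1E x : g1 x x = g (T (Ti x)) (Ti x) by rewrite symT TiK.
have ig1 : inner_product g1.
  split; last first.
    move=> x; rewrite g1E => g0; rewrite -(TiK x) -[RHS]T0; congr (T _).
    by apply: contrapT => /eqP/posT; rewrite ltcE g0 ltxx andbF.
  split; last first.
    move=> x; rewrite g1E; have [->|/posT] := eqVneq (Ti x) 0.
      by rewrite (herm0r hg).
    by rewrite ltcE => /andP[_ /ltW].
  split=> [a x y z|x y]; first by rewrite /g1 linearP (hermDl hg) (hermZl hg).
  rewrite /g1 -{1}(TiK x) -symT TiK; exact: herm_conj.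
have g1T x y : g1 (T x) y = g x y by rewrite /g1 TK.
have le1 x : ip_norm g x <= Num.sqrt (`|M| + 1) * ip_norm g1 x.
  have [->|x_neq0] := eqVneq (ip_norm g x) 0.
    by rewrite mulr_ge0 ?sqrtr_ge0 ?ip_norm_ge0.
  have x0 : 0 < ip_norm g x by rewrite lt_def x_neq0 ip_norm_ge0.
  rewrite -(ler_pM2l x0) -expr2 (sqr_ip_norm sg) -g1T.
  apply: le_trans (Re_le_normc _) _; apply: le_trans (cauchy_schwarz ig1.1 _ _) _.
  rewrite mulrA ler_wpM2r ?ip_norm_ge0 //.
  apply: (ip_norm_le ig1.1); first by rewrite mulr_ge0 ?ip_norm_ge0 ?sqrtr_ge0.
  rewrite g1T exprMn (sqr_sqrtr (ltW M0)).
  apply: le_trans (Re_le_normc _) _; apply: le_trans (cauchy_schwarz sg _ _) _.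
  by rewrite expr2 -mulrA ler_wpM2l ?ip_norm_ge0 // mulrC.
have le2 x : ip_norm g1 x <= Num.sqrt (`|N| + 1) * ip_norm g x.
  apply: (ip_norm_le ig1.1); first by rewrite mulr_ge0 ?ip_norm_ge0 ?sqrtr_ge0.
  rewrite exprMn (sqr_sqrtr (ltW N0)).
  apply: le_trans (Re_le_normc _) _; apply: le_trans (cauchy_schwarz sg _ _) _.
  by rewrite expr2 mulrA ler_wpM2r ?ip_norm_ge0.
have sM : 0 < Num.sqrt (`|M| + 1) by rewrite sqrtr_gt0.
have sN : 0 < Num.sqrt (`|N| + 1) by rewrite sqrtr_gt0.
exists g1; split=> //.
- exact: (@complete_ip_equiv _ _ _ cg _ _ _ sM sN le1 le2).
- by exists (Num.sqrt (`|M| + 1)).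
- by exists (Num.sqrt (`|N| + 1)).
Qed.

(** The graph of a uniform contraction is maximal: a larger uniformly positive
    subspace would contain a nonzero vector of the negative summand. *)
Lemma contraction_graph_maximal (R : realType) (H : lmodType R[i])
    (form : hermitian_form H) (Gp Gm Hp Hm : submodClosed H)
    (Q : subspace Hp -> subspace Hm) (k : R) :
  fundamental_decomposition form Gp Gm -> fundamental_decomposition form Hp Hm ->
  linear Q -> 0 <= k -> k < 1 ->
  (forall x, ip_norm (neg_form form Hm) (Q x) <= k * ip_norm (pos_form form Hp) x) ->
  maximal_uniformly_positive (fund_ip form Gp Gm) form
    (range (fun x => \val x + \val (Q x))).
Proof.
move=> fdG fd linQ k0 k1 hQ; pose T (x : subspace Hp) := \val x + \val (Q x).
have hf := hermitian_form_fun form.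
have igp := pos_form_ip fd; have igm := neg_form_ip fd.
have linT : linear T.
  by move=> a x y; rewrite /T linQ !subspace_valP scalerDr addrACA.
have T0 : T 0 = 0 by have := linT (-1) 0 0; rewrite !scaleN1r oppr0 addr0 addNr.
have TB x y : T (x - y) = T x - T y.
  by have := linT (-1) y x; rewrite !scaleN1r ![- _ + _]addrC.
have [C C0 hC] := fund_norm_equiv fdG fd.
have formT x : Re (form (T x) (T x)) =
    ip_norm (pos_form form Hp) x ^+ 2 - ip_norm (neg_form form Hm) (Q x) ^+ 2.
  rewrite (sqr_ip_norm igp.1) (sqr_ip_norm igm.1) /T (Re_hermD hf).
  rewrite (form_pos_neg fd (valP x) (valP (Q x))) /= /opp_form ReN opprK.
  by rewrite mulr0 addr0.
have normT x : ip_norm (fund_ip form Gp Gm) (T x) <=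
    C * 2 * ip_norm (pos_form form Hp) x.
  apply: le_trans (hC _) _; rewrite -mulrA ler_pM2l //.
  apply: le_trans (ip_normD (fund_ip_inner_product fd).1 _ _) _.
  rewrite (fund_norm_pos fd) (fund_norm_neg fd) mulr2n mulrDl mul1r lerD2l.
  apply: le_trans (hQ x) _; rewrite -[leRHS]mul1r ler_wpM2r ?ip_norm_ge0 //.
  exact: ltW.
have k2 : 0 < 1 - k ^+ 2.
  have : k ^+ 2 <= k by rewrite expr2 -[leRHS]mulr1 ler_wpM2l // ltW.
  lra.
split.
- apply/submod_closedP; split; first by exists 0.
  by move=> a _ _ [x _ <-] [y _ <-]; exists (a *: x + y) => //; exact: linT.
- exists ((1 - k ^+ 2) / (C * 2) ^+ 2).
    by rewrite divr_gt0 // exprn_gt0 // mulr_gt0.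
  move=> _ [x _ <-]; rewrite -/(T x) formT.
  have n1 : ip_norm (fund_ip form Gp Gm) (T x) ^+ 2 <=
      (C * 2) ^+ 2 * ip_norm (pos_form form Hp) x ^+ 2.
    rewrite -exprMn ler_pXn2r ?nnegrE ?ip_norm_ge0 //.
    by rewrite !mulr_ge0 ?ip_norm_ge0 // ltW.
  have n2 : ip_norm (neg_form form Hm) (Q x) ^+ 2 <=
      k ^+ 2 * ip_norm (pos_form form Hp) x ^+ 2.
    by rewrite -exprMn ler_pXn2r ?nnegrE ?mulr_ge0 ?ip_norm_ge0.
  apply: (@le_trans _ _ ((1 - k ^+ 2) * ip_norm (pos_form form Hp) x ^+ 2)).
    by rewrite -mulrA ler_pM2l // ler_pdivrMl // exprn_gt0 // mulr_gt0.
  lra.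
- move=> L' /submod_closedP[_ L'D] [al al0 upL'] sub.
  apply/seteqP; split=> // z L'z; exists (pos_part fd z) => //.
  set u := neg_part fd z - Q (pos_part fd z).
  have uE : \val u = z - T (pos_part fd z).
    rewrite /u /T subspace_valB -[X in _ = X - _](part_sum fd z).
    by rewrite opprD addrACA subrr add0r.
  have L'u : L' (\val u).
    rewrite uE addrC -scaleN1r; apply: L'D => //.
    by apply: sub; exists (pos_part fd z).
  have := upL' _ L'u; set w := ip_norm _ _ => h.
  have w0 : 0 <= al * w ^+ 2 by rewrite mulr_ge0 ?sqr_ge0 // ltW.
  have u0 : u = 0.
    apply: igm.2; apply/eqP; rewrite eq_le igm.1.2 andbT.
    by rewrite /= /opp_form ReN oppr_le0; exact: le_trans w0 h.
  by apply/esym/eqP; rewrite -subr_eq0 -[X in _ - X]/(T _) -uE u0.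
Qed.

(** Synthesis with a family whose [P]-part is the image under [T] of an
    orthonormal basis [e]: expansions in [e] turn into sums of the family. *)
Section FrameFromBasis.
Context {R : realType} {H V : lmodType R[i]} (ip : H -> H -> R[i]).
Context (iip : inner_product ip).
Context (g : V -> V -> R[i]) (ig : inner_product g) (cg : complete_ip g).
Context (I : choiceType) (e : I -> V) (oe : orthonormal_family g e).
Context (expand : forall x, sums_to g (fun i => g x (e i) *: e i) x).
Context (T : V -> H) (linT : linear T) (M : R) (M0 : 0 <= M).
Context (hT : forall x, ip_norm ip (T x) <= M * ip_norm g x).
Context (P : pred I) (f : I -> H) (fE : forall i, restrict_fam P f i = T (e i)).

Lemma synthesis_eq (a : I -> R[i]) x : sums_to g (fun i => a i *: e i) x ->
  synthesis ip P f a = T x.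
Proof.
move=> hx; have T0 : T 0 = 0 by have := linT (-1) 0 0; rewrite !scaleN1r oppr0 addr0 addNr.
apply: (usumE iip); apply: (eq_sums_to _ (sums_to_map linT M0 hT hx)) => i /=.
have -> : T (a i *: e i) = a i *: T (e i) by have := linT (a i) (e i) 0; rewrite T0 !addr0.
by rewrite -fE /restrict_fam; case: ifP => // _; rewrite scaler0.
Qed.

Lemma synthesis_range : synthesis ip P f @` @ell2 R I = range T.
Proof.
apply/seteqP; split=> [_ [a /ell2P ha <-]|_ [x _ <-]].
  have [x hx] := bessel_sums_to ig cg ler01 (orthonormal_bessel ig oe) ha.
  by exists x => //; rewrite (synthesis_eq hx).
exists (fun i => g x (e i)); last exact: synthesis_eq.
by apply/ell2P; exact: bessel_sq_summable (orthonormal_bessel ig oe).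
Qed.

End FrameFromBasis.

Lemma block_J_frame_operator (R : realType) (H : lmodType R[i])
    (form : hermitian_form H) (Gp Gm Hp Hm : submodClosed H) (S : H -> H) :
  fundamental_decomposition form Gp Gm -> fundamental_decomposition form Hp Hm ->
  block_representation form Hp Hm S ->
  is_J_frame_operator form (fund_ip form Gp Gm) S.
Proof.
move=> fdG fd [A [K [K' [D [blockS posA contrK adjK [_ posC]]]]]].
have hf := hermitian_form_fun form.
pose gp := pos_form form Hp; pose gm := neg_form form Hm.
have igp : inner_product gp := pos_form_ip fd.
have igm : inner_product gm := neg_form_ip fd.
have cgp : complete_ip gp := pos_form_complete fd.
have cgm : complete_ip gm := neg_form_complete fd.
pose ip := fund_ip form Gp Gm; pose ipH := fund_ip form Hp Hm.
have iip : inner_product ip := fund_ip_inner_product fdG.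
pose C (y : subspace Hm) := D y + K' (A (K y)).
have [[[MA hMA] _] _ _] := posA; have [[[MC hMC] _] _ _] := posC.
have [k [k0 k1 hK]] := contraction_bound igm igp contrK.
have hK' (x : subspace Hp) : ip_norm gm (K' x) <= k * ip_norm gp x.
  exact: (adjoint_bound igp igm (is_adjoint_sym igm igp adjK) k0 hK).
have [g1 [ig1 cg1 g1A [c1 c10 le1] [d1 d10 ge1]]] := inverse_inner_product igp cgp posA.
have [g2 [ig2 cg2 g2C [c2 c20 le2] [d2 d20 ge2]]] := inverse_inner_product igm cgm posC.
(* at each index at most one of the two bases is nonzero; indices where both
   vanish carry the zero vector, which is of positive type *)
pose I : choiceType := (subspace Hp + subspace Hm)%type.
have [||e1 [oe1 e1N expand1]] := orthonormal_basis_exists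
    (k := fun i : I => if i is inl v then Some v else None) ig1 cg1.
- by move=> v; exists (inl v).
- by move=> [?|?] [?|?] v //= [->] [->].
have [||e2 [oe2 e2N expand2]] := orthonormal_basis_exists
    (k := fun i : I => if i is inr v then Some v else None) ig2 cg2.
- by move=> v; exists (inr v).
- by move=> [?|?] [?|?] v //= [->] [->].
have e12 i : e1 i = 0 \/ e2 i = 0.
  by case: i => v; [right; exact: e2N|left; exact: e1N].
pose T (x : subspace Hp) := \val x + \val (K' x) : H.
pose U (y : subspace Hm) := \val y : H.
have linT : linear T.
  by move=> a x y; rewrite /T !linearP /= scalerDr addrACA.
have linU : linear U by move=> a x y; exact: subspace_valP.
have T0 : T 0 = 0 by rewrite /T !linear0 addr0.
pose f i := T (e1 i) + U (e2 i).
have [CG CG0 hCG] := fund_norm_equiv fdG fd.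
have [CH CH0 hCH] := fund_norm_equiv fd fdG.
have formT (x : subspace Hp) : 0 <= Re (form (T x) (T x)).
  rewrite /T (Re_hermD hf) (form_pos_neg fd (valP x) (valP (K' x))) mulr0 addr0.
  have : ip_norm gm (K' x) ^+ 2 <= ip_norm gp x ^+ 2.
    rewrite ler_pXn2r ?nnegrE ?ip_norm_ge0 //; apply: le_trans (hK' x) _.
    by rewrite -[leRHS]mul1r ler_wpM2r ?ip_norm_ge0 // ltW.
  rewrite (sqr_ip_norm igp.1) (sqr_ip_norm igm.1).
  by rewrite /gm /= /opp_form ReN /sub_form; lra.
have signs i : pos_idx form f i = (e2 i == 0) /\ neg_idx form f i = (e2 i != 0).
  have sgn x : (0 <= form x x) = (0 <= Re (form x x)) /\
      (form x x < 0) = (Re (form x x) < 0).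
    by rewrite lecE ltcE /= (Im_herm hf) eqxx.
  rewrite /pos_idx /neg_idx /= (sgn _).1 (sgn _).2 ltNge.
  suff -> : (0 <= Re (form (f i) (f i))) = (e2 i == 0) by [].
  have [e20|e2_neq0] := eqVneq (e2 i) 0.
    by rewrite /f e20 [U 0]/= addr0 formT.
  have [e10|e20] := e12 i; last by rewrite e20 eqxx in e2_neq0.
  rewrite /f e10 T0 add0r; apply/negbTE; rewrite -ltNge.
  have := igm.1.2 (e2 i); rewrite le_eqVlt => /orP[/eqP/esym/igm.2 e20|].
    by rewrite e20 eqxx in e2_neq0.
  by rewrite /gm /= /opp_form ReN oppr_gt0.
have fpos i : restrict_fam (pos_idx form f) f i = T (e1 i).
  rewrite /restrict_fam (signs i).1; have [e20|e2_neq0] := eqVneq (e2 i) 0.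
    by rewrite /f e20 [U 0]/= addr0.
  by have [->|e20] := e12 i; [rewrite T0|rewrite e20 eqxx in e2_neq0].
have fneg i : restrict_fam (neg_idx form f) f i = U (e2 i).
  rewrite /restrict_fam (signs i).2; have [->//|e2_neq0] := eqVneq (e2 i) 0.
  have [e10|e20] := e12 i; last by rewrite e20 eqxx in e2_neq0.
  by rewrite /f e10 T0 add0r.
have normT x : ip_norm ip (T x) <= CG * 2 * c1 * ip_norm g1 x.
  apply: le_trans (hCG _) _; rewrite -!mulrA ler_pM2l //.
  apply: le_trans (ip_normD (fund_ip_inner_product fd).1 _ _) _.
  rewrite (fund_norm_pos fd) (fund_norm_neg fd).
  have h1 := le1 x; have h2 := hK' x.
  have : k * ip_norm gp x <= ip_norm gp x.
    by rewrite -[leRHS]mul1r ler_wpM2r ?ip_norm_ge0 // ltW.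
  move: h1 h2; rewrite -/gp -/gm; lra.
have normU y : ip_norm ip (U y) <= CG * c2 * ip_norm g2 y.
  apply: le_trans (hCG _) _; rewrite -mulrA ler_pM2l //.
  by rewrite (fund_norm_neg fd).
have C10 : 0 <= CG * 2 * c1 by rewrite !mulr_ge0 // ltW.
have C20 : 0 <= CG * c2 by rewrite mulr_ge0 // ltW.
pose w z := pos_part fd z - K (neg_part fd z).
have formT1 z x : form z (T x) = g1 (A (w z)) x.
  rewrite g1A (hermBl igp.1.1) adjK /T (hermDr hf); congr (_ + _).
    rewrite -{1}(part_sum fd z) (hermDl hf).
    by rewrite (form_neg_pos fd (valP (neg_part fd z)) (valP x)) addr0.
  rewrite -{1}(part_sum fd z) (hermDl hf) /= /opp_form opprK.
  by rewrite (form_pos_neg fd (valP (pos_part fd z)) (valP (K' x))) add0r.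
have formU z y : form z (U y) = g2 (- C (neg_part fd z)) y.
  rewrite (hermNl ig2.1.1) g2C -{1}(part_sum fd z) (hermDl hf) /= /opp_form opprK.
  by rewrite (form_pos_neg fd (valP (pos_part fd z)) (valP y)) add0r.
have synp z : synthesis ip (pos_idx form f) f (fun i => form z (f i)) = T (A (w z)).
  apply: (synthesis_eq iip linT C10 normT fpos).
  apply: eq_sums_to (expand1 (A (w z))) => i.
  have [->|e20] := e12 i; first by rewrite !scaler0.
  by rewrite /f e20 [U 0]/= addr0 formT1.
have synm z : synthesis ip (neg_idx form f) f (fun i => form z (f i)) =
    U (- C (neg_part fd z)).
  apply: (synthesis_eq iip linU C20 normU fneg).
  apply: eq_sums_to (expand2 (- C (neg_part fd z))) => i.
  have [e10|->] := e12 i; last by rewrite !scaler0.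
  by rewrite /f e10 T0 add0r formU.
exists I, f; split; last first.
  move=> z; have -> : J_frame_op form ip f z =
      T (A (w z)) - U (- C (neg_part fd z)) by rewrite -synp -synm.
  rewrite -{1}(part_sum fd z) blockS /T /U /C /w.
  set x := pos_part fd z; set y := neg_part fd z.
  rewrite !(linearB, linearD, linearN) /= -!addrA; congr (_ + (_ + (_ + _))).
  by rewrite !opprK addrC addrK.
have wle z : ip_norm gp (w z) <= 2 * ip_norm ipH z.
  apply: le_trans (ip_normD igp.1 _ _) _; rewrite (ip_normN igp.1).
  have h1 := pos_part_norm_le fd z; have h2 := neg_part_norm_le fd z.
  have h3 := hK (neg_part fd z).
  have : k * ip_norm gm (neg_part fd z) <= ip_norm gm (neg_part fd z).
    by rewrite -[leRHS]mul1r ler_wpM2r ?ip_norm_ge0 // ltW.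
  by move: h1 h2 h3; rewrite -/gp -/gm -/ipH; lra.
split.
- pose b1 := d1 * (`|MA| * (2 * CH)); pose b2 := d2 * (`|MC| * CH).
  have bound1 z : ip_norm g1 (A (w z)) <= b1 * ip_norm ip z.
    rewrite /b1 -!mulrA; apply: le_trans (ge1 _) _; rewrite ler_pM2l //.
    apply: le_trans (hMA _) _.
    apply: le_trans (ler_wpM2r (ip_norm_ge0 _ _) (ler_norm _)) _.
    rewrite ler_wpM2l // ; apply: le_trans (wle z) _.
    by rewrite ler_pM2l //; exact: hCH.
  have bound2 z : ip_norm g2 (- C (neg_part fd z)) <= b2 * ip_norm ip z.
    rewrite (ip_normN ig2.1) /b2 -!mulrA; apply: le_trans (ge2 _) _.
    rewrite ler_pM2l //; apply: le_trans (hMC _) _.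
    apply: le_trans (ler_wpM2r (ip_norm_ge0 _ _) (ler_norm _)) _.
    rewrite ler_wpM2l //; apply: le_trans (neg_part_norm_le fd z) _; exact: hCH.
  exists (b1 ^+ 2 + b2 ^+ 2) => x.
  apply/esum_leP => [i|B]; first exact: sqr_ge0.
  set z := component Gp Gm x - component Gm Gp x.
  have nz : ip_norm ip z = ip_norm ip x by exact: symmetry_norm.
  have coef i : normc (fund_ip form Gp Gm x (f i)) ^+ 2 =
      normc (g1 (A (w z)) (e1 i)) ^+ 2 +
      normc (g2 (- C (neg_part fd z)) (e2 i)) ^+ 2.
    rewrite (herm_conj (fund_ip_inner_product fdG).1.1) (fund_ip_form fdG) -(herm_conj hf) -/z /f.
    have [->|->] := e12 i.
      by rewrite T0 add0r formU (herm0r ig1.1.1) normc0 expr0n add0r.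
    by rewrite [U 0]/= addr0 formT1 (herm0r ig2.1.1) normc0 expr0n addr0.
  under eq_bigr do rewrite coef.
  rewrite big_split /= mulrDl -!exprMn -/ip -nz; apply: lerD.
    apply: le_trans (orthonormal_bessel ig1 oe1 _ _) _.
    rewrite mul1r ler_pXn2r ?nnegrE ?ip_norm_ge0 //.
    exact: le_trans (ip_norm_ge0 _ _) (bound1 z).
  apply: le_trans (orthonormal_bessel ig2 oe2 _ _) _.
  rewrite mul1r ler_pXn2r ?nnegrE ?ip_norm_ge0 //.
  exact: le_trans (ip_norm_ge0 _ _) (bound2 z).
- rewrite (synthesis_range iip ig1 cg1 oe1 expand1 linT C10 normT fpos).
  by apply: (contraction_graph_maximal fdG fd _ k0 k1 hK'); exact: linearP.
rewrite (synthesis_range iip ig2 cg2 oe2 expand2 linU C20 normU fneg).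
have := @contraction_graph_maximal _ _ _ _ _ _ _ (fun=> 0) 0
  (fundamental_decomposition_opp fdG) (fundamental_decomposition_opp fd).
have <- : (fun y : subspace Hm => \val y + \val (0 : subspace Hp)) = U.
  by apply/funext => y; rewrite linear0 addr0.
rewrite fund_ip_opp; apply=> // [a x y|x]; first by rewrite scaler0 addr0.
by rewrite (ip_norm0 (neg_form_ip (fundamental_decomposition_opp fd)).1) mul0r.
Qed.

Theorem theorem3p1 (R : realType) (H : lmodType R[i])
    (form : hermitian_form H)
    (Gp Gm : submodClosed H) (krein : fundamental_decomposition form Gp Gm)
    (S : {linear H -> H})
    (S_bounded : bounded_op (fund_ip form Gp Gm) (fund_ip form Gp Gm) S)
    (S_selfadjoint : is_adjoint form form S S) :
  is_J_frame_operator form (fund_ip form Gp Gm) S <->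
  exists Hp Hm : submodClosed H,
    fundamental_decomposition form Hp Hm /\
    exists (A : {linear subspace Hp -> subspace Hp})
           (K : {linear subspace Hm -> subspace Hp})
           (K' : {linear subspace Hp -> subspace Hm})
           (D : {linear subspace Hm -> subspace Hm}),
      [/\ block_operator S A (fun y => - A (K y)) (fun x => K' (A x)) D,
          uniformly_positive_op (pos_form form Hp) A,
          uniform_contraction (neg_form form Hm) (pos_form form Hp) K,
          is_adjoint (neg_form form Hm) (pos_form form Hp) K K'
        & bounded_selfadjoint (neg_form form Hm) D /\
          uniformly_positive_op (neg_form form Hm)
            (fun y => D y + K' (A (K y)))].
Proof.
split; first exact: J_frame_operator_block.
by move=> [Hp [Hm [fd block]]]; exact: block_J_frame_operator krein fd block.
Qed.
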